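(* Let $(M,g)$ be a Riemannian manifold, let $\pi:E\to M$ be a vector bundle of rank $k\ge1$ with fiber metric $h$ and compatible connection $D$, and let $G$ be the spherically symmetric metric on the total space $E$ with weight functions $\varphi_1=\varphi_2=0$ (i.e., $G$ is the Sasaki metric). Let $\alpha:[0,+\infty)\to\mathbb{R}$ be smooth and let $F:E\to\mathbb{R}$, $F(e)=\alpha(r)$ with $r=h(e,e)$, be the $r$-radial function constructed from $\alpha$. Then $F$ is biharmonic on $(E,G)$ if and only if $\alpha$ satisfies the linear differential equation $$2r^2\alpha^{(4)}+(3k+4)r\alpha^{(3)}+k(k+2)\alpha^{(2)}=0 .$$
   Context: All manifolds and geometric objects are smooth ($C^\infty$); manifolds are connected and without boundary. $(E,\pi,M)$ is a real vector bundle of rank $k$ over the Riemannian manifold $(M,g)$, with a (Riemannian) fiber metric $h$ and a connection $D$ with $Dh=0$. Let $K$ be the connection map of $D$. A spherically symmetric metric on $E$ is $G_e(X,Y)=e^{2\varphi_1}g(d\pi(X),d\pi(Y))+e^{2\varphi_2}h(K_e(X),K_e(Y))$ for $X,Y\in T_eE$, with $\varphi_1,\varphi_2$ functions of $r=h(e,e)$; for $\varphi_1=\varphi_2=0$ it is the Sasaki metric $G_e(X,Y)=g(d\pi(X),d\pi(Y))+h(K_e(X),K_e(Y))$. Here $\alpha$ and all its successive derivatives are smooth on $(0,+\infty)$ and at $r=0$ on the right; $\alpha^{(j)}$ denotes the $j$-th derivative. A smooth function $F$ on $(E,G)$ is biharmonic if $\Delta_G^2F=\Delta_G(\Delta_GF)=0$,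 with $\Delta_G$ the Laplace–Beltrami operator. *)

(* Defs.v *)
From HB Require Import structures.
From mathcomp Require Import all_boot all_order all_algebra.
From mathcomp Require Import all_classical all_reals all_analysis.

Set Implicit Arguments.
Unset Strict Implicit.
Unset Printing Implicit Defensive.

Import Order.TTheory GRing.Theory Num.Theory numFieldNormedType.Exports.
Local Open Scope classical_set_scope.
Local Open Scope ring_scope.

(* U is meant to be an open subset of a finite-dimensional space V: there f is
   of class C^(m+1) iff it is differentiable and all its directional
   derivatives are of class C^m. *)
Fixpoint diff_class (R : realType) (m : nat) (V W : normedModType R)
    (U : set V) (f : V -> W) : Prop :=
  match m with
  | 0%N => forall x, U x -> {for x, continuous f}
  | m'.+1 => (forall x, U x -> differentiable f x) /\
             (forall v : V, diff_class m' U ('D_v f))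
  end.

Definition smooth_on (R : realType) (V W : normedModType R)
    (U : set V) (f : V -> W) : Prop := forall m, diff_class m U f.

(* Functions on [0, +oo[ are represented by functions on R whose values on
   negative numbers are irrelevant. The derivative is taken within [0, +oo[:
   it is the usual one on ]0, +oo[ and the right derivative at 0. *)
Definition halfline_quotient (R : realType) (a : R -> R) (r : R) : set_system R :=
  (a s - a r) / (s - r) @[s --> within [set s | 0 <= s] r^'].

Definition halfline_derive (R : realType) (a : R -> R) (r : R) : R :=
  lim (halfline_quotient a r).

Definition halfline_deriven (R : realType) (j : nat) (a : R -> R) : R -> R :=
  iter j (@halfline_derive R) a.

Definition smooth_halfline (R : realType) (a : R -> R) : Prop :=
  forall j r, 0 <= r -> cvg (halfline_quotient (halfline_deriven j a) r).

(* cmap is relevant only on cdom, and cinv only on the image of cdom. *)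
Record chart (R : realType) (X : Type) (N : nat) := Chart {
  cdom : set X;
  cmap : X -> 'rV[R]_N;
  cinv : 'rV[R]_N -> X
}.

Definition homeo_chart (R : realType) (X : topologicalType) (N : nat)
    (c : chart R X N) : Prop :=
  [/\ open (cdom c), open (cmap c @` cdom c),
      (forall p, cdom c p -> cinv c (cmap c p) = p),
      (forall p, cdom c p -> {for p, continuous (cmap c)}) &
      (forall x, (cmap c @` cdom c) x -> {for x, continuous (cinv c)})].

Definition smooth_fun (R : realType) (X : Type) (N : nat)
    (atlas : set (chart R X N)) (W : normedModType R)
    (U : set X) (f : X -> W) : Prop :=
  forall c, atlas c -> smooth_on (cmap c @` (cdom c `&` U)) (f \o cinv c).

(* A connected manifold is taken to be nonempty. The field chart_at selects an
   atlas chart around each point; it only serves to represent tangent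
   vectors, see tangent below. *)
Record manifold (R : realType) (N : nat) (M : topologicalType) := Manifold {
  atlas : set (chart R M N);
  chart_at : M -> chart R M N;
  manifold_hausdorff : hausdorff_space M;
  manifold_second_countable : @second_countable M;
  manifold_connected : connected [set: M];
  manifold_nonempty : [set: M] !=set0;
  atlas_homeo : forall c, atlas c -> homeo_chart c;
  atlas_smooth : forall c c', atlas c -> atlas c' ->
    smooth_on (cmap c @` (cdom c `&` cdom c')) (cmap c' \o cinv c);
  chart_at_atlas : forall p, atlas (chart_at p);
  chart_at_dom : forall p, cdom (chart_at p) p
}.

(* The tangent space at p is identified with R^N through the chart at p: a
   tangent vector is given by its components in that chart. *)
Definition tangent (R : realType) (X : Type) (N : nat)
    (at_ : X -> chart R X N) (p : X) : normedModType R := 'rV[R]_N.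

(* The i-th coordinate vector field of the chart c, at a point p of its
   domain: the vector of components e_i in c is expressed in the chart at p. *)
Definition coord_vec (R : realType) (X : Type) (N : nat)
    (at_ : X -> chart R X N) (c : chart R X N) (p : X) (i : 'I_N) :
    tangent at_ p :=
  'D_(delta_mx 0 i : 'rV[R]_N) (cmap (at_ p) \o cinv c) (cmap c p).

Definition tangent_coord (R : realType) (X : Type) (N : nat)
    (at_ : X -> chart R X N) (c : chart R X N) (p : X)
    (v : tangent at_ p) : 'rV[R]_N :=
  'D_v (cmap c \o cinv (at_ p)) (cmap (at_ p) p).

Definition tangent_derive (R : realType) (X : Type) (N : nat)
    (at_ : X -> chart R X N) (p : X) (v : tangent at_ p) (f : X -> R) : R :=
  'D_v (f \o cinv (at_ p)) (cmap (at_ p) p).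

Definition metric_coef (R : realType) (X : Type) (N : nat)
    (at_ : X -> chart R X N)
    (G : forall p, tangent at_ p -> tangent at_ p -> R)
    (c : chart R X N) (x : 'rV[R]_N) : 'M[R]_N :=
  \matrix_(i, j) G (cinv c x) (coord_vec at_ c (cinv c x) i)
                              (coord_vec at_ c (cinv c x) j).

(* 1 / sqrt |G| * d_i (sqrt |G| * G^ij * d_j f) *)
Definition coord_laplacian (R : realType) (N : nat) (G : 'rV[R]_N -> 'M[R]_N)
    (f : 'rV[R]_N -> R) (x : 'rV[R]_N) : R :=
  (Num.sqrt (\det (G x)))^-1 *
  \sum_(i < N) 'D_(delta_mx 0 i : 'rV[R]_N)
    (fun y => Num.sqrt (\det (G y)) *
       \sum_(j < N) invmx (G y) i j * 'D_(delta_mx 0 j : 'rV[R]_N) f y) x.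

(* The Laplace-Beltrami operator is independent of the coordinates; at p it is
   computed in the chart at p. *)
Definition laplace_beltrami (R : realType) (X : Type) (N : nat)
    (at_ : X -> chart R X N)
    (G : forall p, tangent at_ p -> tangent at_ p -> R)
    (F : X -> R) (p : X) : R :=
  coord_laplacian (metric_coef G (at_ p)) (F \o cinv (at_ p))
    (cmap (at_ p) p).

Definition biharmonic (R : realType) (X : Type) (N : nat)
    (charts : set (chart R X N)) (at_ : X -> chart R X N)
    (G : forall p, tangent at_ p -> tangent at_ p -> R) (F : X -> R) : Prop :=
  smooth_fun charts setT F /\
  forall p, laplace_beltrami G (laplace_beltrami G F) p = 0.

Definition inner_product (R : realType) (V : lmodType R) (b : V -> V -> R) :
    Prop :=
  [/\ forall a x y z, b (a *: x + y) z = a * b x z + b y z,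
      forall x y, b x y = b y x &
      forall x, x != 0 -> 0 < b x x].

Definition riemannian_metric (R : realType) (n : nat) (M : topologicalType)
    (A : manifold R n M)
    (g : forall p, tangent (chart_at A) p -> tangent (chart_at A) p -> R) :
    Prop :=
  (forall p, inner_product (g p)) /\
  forall c, atlas A c -> forall i j : 'I_n,
    smooth_fun (atlas A) (cdom c)
      (fun p => g p (coord_vec (chart_at A) c p i)
                    (coord_vec (chart_at A) c p j)).

(* A local trivialization of the family of vector spaces V over tdom: p and
   v : V p are sent to (p, tcoord p v). *)
Record trivialization (R : realType) (M : Type) (V : M -> lmodType R)
    (k : nat) := Trivialization {
  tdom : set M;
  tcoord : forall p, V p -> 'rV[R]_k;
  tinv : forall p, 'rV[R]_k -> V p
}.

Definition linear_trivialization (R : realType) (M : topologicalType)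
    (V : M -> lmodType R) (k : nat) (t : trivialization V k) : Prop :=
  [/\ open (tdom t),
      forall p, tdom t p -> linear (@tcoord _ _ _ _ t p),
      forall p, tdom t p -> cancel (@tcoord _ _ _ _ t p) (tinv t p) &
      forall p, tdom t p -> cancel (tinv t p) (@tcoord _ _ _ _ t p)].

(* The vector bundle with fibers V p; its total space is {p : M & V p}, with
   the smooth structure defined by the charts bundle_chart below. *)
Record vector_bundle (R : realType) (n : nat) (M : topologicalType)
    (A : manifold R n M) (V : M -> lmodType R) (k : nat) := VectorBundle {
  trivs : set (trivialization V k);
  triv_at : M -> trivialization V k;
  trivs_linear : forall t, trivs t -> linear_trivialization t;
  trivs_smooth : forall t t', trivs t -> trivs t' -> forall u : 'rV[R]_k,
    smooth_fun (atlas A) (tdom t `&` tdom t')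
      (fun p => tcoord t' (tinv t p u));
  triv_at_trivs : forall p, trivs (triv_at p);
  triv_at_dom : forall p, tdom (triv_at p) p
}.

Definition total (R : realType) (M : Type) (V : M -> lmodType R) :=
  {p : M & V p}.

Definition bundle_chart (R : realType) (M : Type) (V : M -> lmodType R)
    (n k : nat) (c : chart R M n) (t : trivialization V k) :
    chart R (total V) (n + k) := {|
  cdom := [set e | cdom c (tag e) /\ tdom t (tag e)];
  cmap := fun e => row_mx (cmap c (tag e)) (tcoord t (tagged e));
  cinv := fun z => existT _ (cinv c (lsubmx z))
                            (tinv t (cinv c (lsubmx z)) (rsubmx z))
|}.

Section Bundle.
Variables (R : realType) (n k : nat) (M : topologicalType) (A : manifold R n M).
Variables (V : M -> lmodType R) (B : vector_bundle A V k).

Definition bundle_atlas : set (chart R (total V) (n + k)) :=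
  [set C | exists c t, [/\ atlas A c, trivs B t & C = bundle_chart c t]].

Definition bundle_chart_at (e : total V) : chart R (total V) (n + k) :=
  bundle_chart (chart_at A (tag e)) (triv_at B (tag e)).

Definition smooth_section (U : set M) (s : forall p, V p) : Prop :=
  forall t, trivs B t ->
    smooth_fun (atlas A) (U `&` tdom t) (fun p => tcoord t (s p)).

Definition smooth_vector_field (U : set M)
    (X : forall p, tangent (chart_at A) p) : Prop :=
  forall c, atlas A c ->
    smooth_fun (atlas A) (U `&` cdom c) (fun p => tangent_coord c (X p)).

Definition smooth_near (p : M) (f : M -> R) : Prop :=
  exists U, [/\ open U, U p & smooth_fun (atlas A) U f].

Definition smooth_section_near (p : M) (s : forall q, V q) : Prop :=
  exists U, [/\ open U, U p & smooth_section U s].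

Definition fiber_metric (h : forall p, V p -> V p -> R) : Prop :=
  (forall p, inner_product (h p)) /\
  forall t, trivs B t -> forall a b : 'I_k,
    smooth_fun (atlas A) (tdom t)
      (fun p => h p (tinv t p (delta_mx 0 a)) (tinv t p (delta_mx 0 b))).

(* D p v s is the covariant derivative at p, in the direction v, of a section
   s that is smooth near p. Such an s is arbitrary away from p, and so is the
   f of the Leibniz rule: taking for f the indicator function of a
   neighborhood of p shows that D p v s depends only on s near p. *)
Definition connection
    (D : forall p, tangent (chart_at A) p -> (forall q, V q) -> V p) : Prop :=
  [/\ forall p (a : R) (v w : tangent (chart_at A) p) s,
        smooth_section_near p s -> D p (a *: v + w) s = a *: D p v s + D p w s,
      forall p v s s',
        smooth_section_near p s -> smooth_section_near p s' ->
        D p v (fun q => s q + s' q) = D p v s + D p v s',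
      forall p v f s,
        smooth_near p f -> smooth_section_near p s ->
        D p v (fun q => f q *: s q) =
          tangent_derive v f *: s p + f p *: D p v s &
      forall U X s, open U -> smooth_vector_field U X -> smooth_section U s ->
        smooth_section U (fun p => D p (X p) s)].

(* D h = 0 *)
Definition metric_connection (h : forall p, V p -> V p -> R)
    (D : forall p, tangent (chart_at A) p -> (forall q, V q) -> V p) : Prop :=
  forall p v s s',
    smooth_section_near p s -> smooth_section_near p s' ->
    tangent_derive v (fun q => h q (s q) (s' q)) =
      h p (D p v s) (s' p) + h p (s p) (D p v s').

(* The chart of the total space at e lies over the chart of M at tag e, so the
   differential of the projection keeps the first n components. *)
Definition dproj (e : total V) (X : tangent bundle_chart_at e) :
    tangent (chart_at A) (tag e) := lsubmx (X : 'rV[R]_(n + k)).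

(* Let s be the local section through e with constant coordinates in the
   trivialization at tag e. Then X is the sum of ds(dproj X), which K sends to
   the covariant derivative of s along dproj X, and of the vertical vector
   with components rsubmx X, which K sends to the corresponding element of
   the fiber. *)
Definition connection_map
    (D : forall p, tangent (chart_at A) p -> (forall q, V q) -> V p)
    (e : total V) (X : tangent bundle_chart_at e) : V (tag e) :=
  let t := triv_at B (tag e) in
  D (tag e) (dproj X) (fun q => tinv t q (tcoord t (tagged e))) +
  tinv t (tag e) (rsubmx (X : 'rV[R]_(n + k))).

Definition sq_norm (h : forall p, V p -> V p -> R) (e : total V) : R :=
  h (tag e) (tagged e) (tagged e).

Definition spherically_symmetric_metric
    (g : forall p, tangent (chart_at A) p -> tangent (chart_at A) p -> R)
    (h : forall p, V p -> V p -> R)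
    (D : forall p, tangent (chart_at A) p -> (forall q, V q) -> V p)
    (phi1 phi2 : R -> R)
    (e : total V) (X Y : tangent bundle_chart_at e) : R :=
  expR (2 * phi1 (sq_norm h e)) * g (tag e) (dproj X) (dproj Y) +
  expR (2 * phi2 (sq_norm h e)) *
    h (tag e) (connection_map D X) (connection_map D Y).

Definition radial_function (h : forall p, V p -> V p -> R) (alpha : R -> R)
    (e : total V) : R := alpha (sq_norm h e).

End Bundle.

Arguments spherically_symmetric_metric {R n k M A V} B g h D phi1 phi2 [e] X Y.

(* Main.v *)
Require Import Defs.
From HB Require Import structures.
From mathcomp Require Import all_boot all_order all_algebra.
From mathcomp Require Import all_classical all_reals all_analysis.
From mathcomp Require Import ring lra.

Set Implicit Arguments.
Unset Strict Implicit.
Unset Printing Implicit Defensive.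

Import Order.TTheory GRing.Theory Num.Theory numFieldNormedType.Exports.
Local Open Scope classical_set_scope.
Local Open Scope ring_scope.

(** Both conditions are equivalent to the vanishing of the second derivative of
    alpha for r >= 0, that is, to alpha being affine.

    Laplacian of a radial function. In a bundle chart with base coordinates x
    and fiber coordinates u, let P be the Gram matrix of g, Q the Gram matrix of
    h, and W the matrix of the covariant derivatives of the section with constant
    coordinates u along the coordinate fields of the base. The connection map
    sends the coordinate fields of the total space to the rows of the column
    block (W; 1), so the Sasaki metric has Gram matrix
      diag(P, 0) + (W; 1) Q (W; 1)^T.
    Its determinant is det P det Q, which does not depend on u
    ([det_fibered_gram], [sasaki_gramE]), and it maps (0, u) to (W; 1) Q u^T.
    Because D h = 0, this is half the differential of r = h(e, e)
    ([is_derive_sq_norm]). So the gradient of a(r) is the vertical field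
    2 a'(r) (0, u), and its divergence only involves derivatives along u:
    the Laplacian of a(r) is 4 r a''(r) + 2 k a'(r)
    ([coord_laplacian_radial], [laplace_beltrami_radial]).

    The differential equations. Applying this formula twice on r > 0 turns
    biharmonicity of alpha(r) into
      4 r^2 alpha'''' + 4 (k + 2) r alpha''' + k (k + 2) alpha'' = 0,
    up to the factor 4. This is not the equation of the theorem, but both are
    Euler equations for alpha'': on alpha'' = r^s the first gives
    (2 s + k + 2) (2 s + k) and the second (2 s + k + 2) (s + k). All these
    exponents are negative since k >= 1, whereas alpha'' and alpha''' have limits
    at 0. So each equation alone forces alpha'' = 0 ([euler2_eq0]).

    Conversely, if alpha'' = 0 on r > 0 then, by continuity at 0, the equation
    of the theorem holds for all r >= 0; and alpha(r) = b0 + b1 r is smooth on E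
    with the constant Laplacian 2 k b1, hence biharmonic
    ([biharmonic_radial_affine]). *)

(** * Gram matrices *)

(** On the segment from S to the identity all matrices are positive definite,
    hence invertible. So the determinant, a polynomial along the segment, has no
    root there and keeps the sign that it has at the identity. *)
Lemma det_posdef_gt0 (R : rcfType) (n : nat) (S : 'M[R]_n) :
  (forall v : 'rV_n, v != 0 -> 0 < (v *m S *m v^T) 0 0) -> 0 < \det S.
Proof.
move=> Spos.
have sq_pos (v : 'rV[R]_n) : v != 0 -> 0 < (v *m v^T) 0 0.
  move=> v0; rewrite mxE.
  have [j vj0] : exists j, v 0 j != 0.
    apply/existsP; apply: contraNT v0; rewrite negb_exists => /forallP v0.
    by apply/eqP/rowP => j; rewrite mxE; apply/eqP; have := v0 j; rewrite negbK.
  rewrite (bigD1 j) //= ltr_pwDl //; first by rewrite mxE -expr2 exprn_even_gt0.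
  by apply: sumr_ge0 => i _; rewrite mxE -expr2 sqr_ge0.
pose p := \det (\matrix_(i, j) ((1%:M i j)%:P * 'X + (S i j)%:P * (1 - 'X))).
have pE s : p.[s] = \det (s *: 1%:M + (1 - s) *: S).
  rewrite -[p.[s]]/(horner_eval s p) -det_map_mx; congr (\det _).
  by apply/matrixP => i j; rewrite !mxE /= /horner_eval !hornerE mulrC [S i j * _]mulrC.
have p_neq0 s : 0 <= s <= 1 -> p.[s] != 0.
  move=> /andP[s0 s1]; rewrite pE; apply/negP => /det0P[v v0 /(congr1 (mulmx^~ v^T))].
  rewrite mul0mx mulmxDr mulmxDl -!scalemxAr mulmx1 -!scalemxAl => /matrixP/(_ 0 0).
  apply/eqP; rewrite gt_eqF // 3!mxE [X in 0 < _ + X]mxE.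
  have [->|s_neq0] := eqVneq s 0.
    by rewrite mul0r add0r subr0 mul1r Spos.
  rewrite ltr_pwDl // ?mulr_gt0 ?sq_pos // ?lt_def ?s_neq0 //.
  by rewrite mulr_ge0 ?subr_ge0 // ltW // Spos.
rewrite ltNge; apply/negP => S_le0.
have [//||s /andP[s0 s1] /eqP/rootP] := @poly_ivt R p 0 1.
  by rewrite !pE scale0r subr0 scale1r add0r S_le0 subrr scale0r addr0 scale1r det1 ler01.
by move=> /rootP ps; have := p_neq0 s; rewrite s0 s1 => /(_ isT); rewrite ps eqxx.
Qed.

(** The matrix is congruent to diag(P, Q) by a unipotent triangular matrix. With P
    and Q the Gram matrices of base and fiber and W the coefficients of the
    connection, this makes the volume density of the total space independent of
    the connection, and so constant along each fiber. *)
Lemma det_fibered_gram (R : comPzRingType) n k (P : 'M[R]_n) (Q : 'M[R]_k)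
    (W : 'M[R]_(n, k)) :
  \det (block_mx P 0 0 0 + col_mx W 1%:M *m Q *m (col_mx W 1%:M)^T) =
  \det P * \det Q.
Proof.
rewrite (_ : _ + _ = block_mx 1%:M W 0 1%:M *m block_mx P 0 0 Q *m
  block_mx 1%:M 0 W^T 1%:M).
  by rewrite !det_mulmx !det_ublock det_lblock !det1 !mul1r !mulr1.
rewrite !mulmx_block !mul1mx !mulmx1 !mul0mx !mulmx0 !addr0 !add0r.
rewrite tr_col_mx trmx1 mul_col_mx mul_col_row !mul1mx !mulmx1 add_block_mx.
by rewrite !add0r.
Qed.

Lemma fibered_gramM (R : comPzRingType) n k (P : 'M[R]_n) (Q : 'M[R]_k)
    (W : 'M[R]_(n, k)) (v : 'cV[R]_k) :
  (block_mx P 0 0 0 + col_mx W 1%:M *m Q *m (col_mx W 1%:M)^T) *m col_mx 0 v =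
  col_mx W 1%:M *m Q *m v.
Proof.
rewrite mulmxDl mul_block_col !mulmx0 !mul0mx !addr0 col_mx0 add0r -mulmxA.
by rewrite tr_col_mx trmx1 mul_row_col mulmx0 mul1mx add0r.
Qed.

Lemma row_mx_line (R : pzRingType) n k (s : R) (v1 x : 'rV[R]_n) (v2 u : 'rV[R]_k) :
  s *: row_mx v1 v2 + row_mx x u = row_mx (s *: v1 + x) (s *: v2 + u).
Proof. by rewrite scale_row_mx add_row_mx. Qed.

Lemma delta_lshift (R : pzRingType) n k (i : 'I_n) :
  delta_mx 0 (lshift k i) = row_mx (delta_mx 0 i) 0 :> 'rV[R]_(n + k).
Proof.
by apply/rowP => l; case: (split_ordP l) => l' ->;
  rewrite ?row_mxEl ?row_mxEr !mxE /= ?eq_lshift ?eq_rlshift.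
Qed.

Lemma delta_rshift (R : pzRingType) n k (a : 'I_k) :
  delta_mx 0 (rshift n a) = row_mx 0 (delta_mx 0 a) :> 'rV[R]_(n + k).
Proof.
by apply/rowP => l; case: (split_ordP l) => l' ->;
  rewrite ?row_mxEl ?row_mxEr !mxE /= ?eq_rshift ?eq_lrshift.
Qed.

Section inner_product.
Variables (R : realType) (V : lmodType R) (b : V -> V -> R).
Hypothesis bP : inner_product b.

Lemma inner_productC x y : b x y = b y x. Proof. by case: bP. Qed.

Lemma inner_productDl x y z : b (x + y) z = b x z + b y z.
Proof. by case: bP => bl _ _; rewrite -[x]scale1r bl mul1r scale1r. Qed.

Lemma inner_product0l z : b 0 z = 0.
Proof. by have := inner_productDl 0 0 z; rewrite addr0; lra. Qed.

Lemma inner_productZl a x z : b (a *: x) z = a * b x z.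
Proof. by case: bP => bl _ _; rewrite -[a *: x]addr0 bl inner_product0l addr0. Qed.

Lemma inner_product_suml m (f : 'I_m -> V) z : b (\sum_i f i) z = \sum_i b (f i) z.
Proof.
apply: (big_morph (fun x => b x z)); [|exact: inner_product0l].
by move=> x y; exact: inner_productDl.
Qed.

Lemma inner_product_sumr m (f : 'I_m -> V) z : b z (\sum_i f i) = \sum_i b z (f i).
Proof.
rewrite inner_productC inner_product_suml; apply: eq_bigr => i _.
exact: inner_productC.
Qed.

Definition gram m (e : 'I_m -> V) : 'M[R]_m := \matrix_(i, j) b (e i) (e j).

Lemma inner_product_gram m (e : 'I_m -> V) (x y : 'rV[R]_m) :
  b (\sum_i x 0 i *: e i) (\sum_i y 0 i *: e i) = (x *m gram e *m y^T) 0 0.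
Proof.
rewrite inner_product_sumr mxE; apply: eq_bigr => j _.
rewrite inner_productC inner_productZl inner_productC inner_product_suml mulrC.
rewrite [in RHS]mxE [y^T _ _]mxE; congr (_ * _); apply: eq_bigr => i _.
by rewrite inner_productZl mxE.
Qed.

Lemma det_gram_gt0 m (e : 'I_m -> V) :
  (forall x : 'rV_m, \sum_i x 0 i *: e i = 0 -> x = 0) -> 0 < \det (gram e).
Proof.
move=> e_free; apply: det_posdef_gt0 => x x0; rewrite -inner_product_gram.
by case: bP => _ _; apply; apply: contra_neq x0; exact: e_free.
Qed.

End inner_product.

(** * Directional derivatives *)

Lemma near_eq_differentiable (R : numFieldType) (V W : normedModType R)
    (f g : V -> W) (x : V) :
  {near x, f =1 g} -> differentiable f x -> differentiable g x.
Proof.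
move=> fg df.
have gE : g \o shift x = cst (g x) + 'd f x +o_ 0 id.
  apply/eqaddoP => e e0; have := diff_locally df => /eqaddoP/(_ e e0).
  have : \forall h \near 0, f (h + x) = g (h + x).
    by move: fg; rewrite (near_shift 0) subr0.
  move=> fgs df0; apply: filterS2 fgs df0 => h fgh.
  by rewrite !fctE /= fgh (nbhs_singleton fg).
apply/diff_locallyP; rewrite (diff_unique _ gE); last exact: diff_continuous.
split => //; exact: diff_continuous.
Qed.

(** A directional derivative only depends on the restriction to a line. This
    reduces derivatives along coordinate vectors to functions of one variable in
    which either the base or the fiber coordinates are frozen. *)
Lemma derive_line (R : numFieldType) (V W : normedModType R) (f : V -> W) (x v : V) :
  'D_v f x = 'D_1 (fun s : R => f (s *: v + x)) 0.
Proof.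
rewrite /derive; set g1 := fun h => h^-1 *: _; set g2 := fun h => h^-1 *: _.
suff -> : g1 = g2 by [].
by apply/funext => s; rewrite /g1 /g2 /= addr0 scale0r add0r [_%:A]mulr1.
Qed.

Lemma is_derive_line (R : numFieldType) (V W : normedModType R) (f : V -> W)
    (x v : V) (d : W) :
  is_derive (0 : R) 1 (fun s : R => f (s *: v + x)) d <-> is_derive x v f d.
Proof.
split=> -[df dE].
- by apply: DeriveDef; [exact: (derivable1P _ _ _).2 df|rewrite derive_line].
- by apply: DeriveDef; [exact: (derivable1P _ _ _).1 df|rewrite -dE (derive_line f)].
Qed.

Lemma near_line (R : realType) (V : normedModType R) (P : V -> Prop) (x v : V) :
  (\forall y \near x, P y) -> \forall s \near (0 : R), P (s *: v + x).
Proof.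
have c : continuous (fun s : R => s *: v + x).
  by move=> s; apply: cvgD; [exact: scalel_continuous|exact: cvg_cst].
by have := c 0; rewrite /continuous_at scale0r add0r => /[apply].
Qed.

Section derive_extra.
Variable R : realType.

Lemma is_derive_comp1 (V : normedModType R) (r : V -> R) (a : R -> R) (x v : V)
    (d b : R) :
  is_derive x v r d -> is_derive (r x) 1 a b -> is_derive x v (a \o r) (b * d).
Proof.
move=> /is_derive_line dr da; apply/is_derive_line.
by apply: is_derive1_comp; rewrite ?scale0r ?add0r.
Qed.

Lemma derive_comp (U V W : normedModType R) (f : U -> V) (g : V -> W) (x v : U) :
  differentiable f x -> differentiable g (f x) ->
  'D_v (g \o f) x = 'D_('D_v f x) g (f x).
Proof.
move=> df dg; rewrite deriveE; last exact: differentiable_comp.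
by rewrite (diff_comp df dg) /= [RHS]deriveE // deriveE.
Qed.

Lemma is_derive_affine_line (V : normedModType R) (w w0 : V) :
  is_derive (0 : R) 1 (fun s : R => s *: w + w0) w.
Proof.
have dw : is_derive (0 : R) 1 ( *:%R^~ w) w.
  apply: DeriveDef; first exact/diff_derivable.
  by rewrite deriveE // diff_val scale1r.
by have := is_deriveD dw (is_derive_cst w0 (0 : R) 1); rewrite addr0.
Qed.

Lemma is_derive_row_mx (V : normedModType R) n k (f : V -> 'rV[R]_n)
    (g : V -> 'rV[R]_k) (x v : V) df dg :
  is_derive x v f df -> is_derive x v g dg ->
  is_derive x v (fun y => row_mx (f y) (g y)) (row_mx df dg).
Proof.
move=> [fx fE] [gx gE].
have rowx : derivable (fun y => row_mx (f y) (g y)) x v.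
  apply/derivable_mxP => i j; rewrite (ord1 i); case: (split_ordP j) => j' ->.
    rewrite (_ : (fun y => _) = fun y => f y 0 j'); last by apply/funext => y; rewrite row_mxEl.
    by move/derivable_mxP: fx.
  rewrite (_ : (fun y => _) = fun y => g y 0 j'); last by apply/funext => y; rewrite row_mxEr.
  by move/derivable_mxP: gx.
apply: DeriveDef => //; rewrite (derive_mx rowx); apply/rowP => j; rewrite mxE.
case: (split_ordP j) => j' ->.
  rewrite (_ : (fun y => _) = fun y => f y 0 j'); last by apply/funext => y; rewrite row_mxEl.
  by rewrite [RHS]row_mxEl -fE (derive_mx fx) [RHS]mxE.
rewrite (_ : (fun y => _) = fun y => g y 0 j'); last by apply/funext => y; rewrite row_mxEr.
by rewrite [RHS]row_mxEr -gE (derive_mx gx) [RHS]mxE.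
Qed.

End derive_extra.

(** * Functions of class C^m *)

Section diff_class.
Variables (R : realType) (V : normedModType R).
Implicit Types (U : set V).

(** Openness is essential: a derivative on U sees f on a neighborhood. This
    lemma is what allows the formulas for the derivatives of sums, products, and
    composites, valid on U only, to be used in inductions on the class. *)
Lemma diff_class_eq (W : normedModType R) m U (f g : V -> W) :
  open U -> (forall x, U x -> f x = g x) -> diff_class m U f -> diff_class m U g.
Proof.
move=> Uo; have near_eq (h1 h2 : V -> W) x :
    (forall x, U x -> h1 x = h2 x) -> U x -> {near x, h1 =1 h2}.
  by move=> h12 Ux; apply: filterS (open_nbhs_nbhs (conj Uo Ux)) => y /h12.
elim: m f g => [|m IH] f g fg /=.
  move=> fc x Ux; change (g y @[y --> x] --> g x); rewrite -fg //; apply: cvg_trans (fc x Ux).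
  exact/near_eq_cvg/near_eq.
move=> [df Df]; split.
  move=> x Ux; apply: (near_eq_differentiable _ (df x Ux)).
  exact: near_eq.
move=> v; apply: IH (Df v) => x Ux; apply: near_eq_derive; exact: near_eq.
Qed.

Lemma diff_class_sub (W : normedModType R) m U U' (f : V -> W) :
  U' `<=` U -> diff_class m U f -> diff_class m U' f.
Proof.
move=> U'U; elim: m f => [|m IH] f /=; first by move=> fc x /U'U; exact: fc.
by move=> [df Df]; split=> [x /U'U|v]; [exact: df|exact/IH].
Qed.

Lemma diff_class_le (W : normedModType R) m U (f : V -> W) :
  diff_class m.+1 U f -> diff_class m U f.
Proof.
elim: m f => [|m IH] f [df Df]; last by split=> // v; exact/IH.
by move=> x Ux; apply: differentiable_continuous; exact: df.
Qed.

Lemma diff_class_cst (W : normedModType R) m U (a : W) :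
  diff_class m U (cst a).
Proof.
elim: m a => [|m IH] a /=; first by move=> x _; exact: cst_continuous.
split=> [x _|v]; first exact: differentiable_cst.
rewrite (_ : 'D_v _ = cst 0) //; by apply/funext => x; rewrite derive_cst.
Qed.

Lemma diff_classD (W : normedModType R) m U (f g : V -> W) :
  open U -> diff_class m U f -> diff_class m U g -> diff_class m U (f + g).
Proof.
move=> Uo; elim: m f g => [|m IH] f g /=.
  by move=> fc gc x Ux; apply: cvgD; [exact: fc|exact: gc].
move=> [df Df] [dg Dg]; split=> [x Ux|v].
  by apply: differentiableD; [exact: df|exact: dg].
apply: diff_class_eq (IH _ _ (Df v) (Dg v)) => // x Ux.
by rewrite deriveD //; apply: diff_derivable; [exact: df|exact: dg].
Qed.

Lemma diff_classM m U (f g : V -> R) :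
  open U -> diff_class m U f -> diff_class m U g -> diff_class m U (f * g).
Proof.
move=> Uo; elim: m f g => [|m IH] f g.
  by move=> fc gc x Ux; apply: cvgM; [exact: fc|exact: gc].
move=> fc gc; have [[df Df] [dg Dg]] := (fc, gc); split=> [x Ux|v].
  by apply: differentiableM; [exact: df|exact: dg].
have := diff_classD Uo (IH _ _ (diff_class_le fc) (Dg v))
  (IH _ _ (diff_class_le gc) (Df v)).
apply: diff_class_eq => // x Ux.
by rewrite deriveM //; apply: diff_derivable; [exact: df|exact: dg].
Qed.

Lemma diff_class_linear (W : normedModType R) m U (f : {linear V -> W}) :
  continuous f -> diff_class m U f.
Proof.
move=> fc; case: m => [|m]; first by move=> x _; exact: fc.
split=> [x _|v]; first exact: linear_differentiable.
rewrite (_ : 'D_v _ = cst (f v)); first exact: diff_class_cst.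
apply/funext => x; rewrite deriveE ?diff_lin //; exact: linear_differentiable.
Qed.

Lemma diff_class_comp_linear (V' W : normedModType R) m (U : set V')
    (L : {linear V -> V'}) (f : V' -> W) :
  open U -> continuous L -> diff_class m U f -> diff_class m (L @^-1` U) (f \o L).
Proof.
move=> Uo Lc; have LUo : open (L @^-1` U) by exact: open_comp.
elim: m f => [|m IH] f /=.
  by move=> fc x Ux; apply: continuous_comp; [exact: Lc|exact: fc].
move=> [df Df]; split=> [x Ux|v].
  by apply: differentiable_comp; [exact: linear_differentiable|exact: df].
apply: diff_class_eq (IH _ (Df (L v))) => // x Ux /=.
have dL : differentiable L x by exact: linear_differentiable.
have dfx := df _ Ux; rewrite deriveE // [RHS]deriveE; last exact: differentiable_comp.
by rewrite (diff_comp dL dfx) /= (diff_lin _ Lc).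
Qed.

Lemma diff_class_sum (W : normedModType R) m U n (f : 'I_n -> V -> W) :
  open U -> (forall i, diff_class m U (f i)) -> diff_class m U (\sum_i f i).
Proof.
move=> Uo fi; apply: (big_ind (diff_class m U)) => //.
  exact: diff_class_cst.
by move=> g1 g2; exact: diff_classD.
Qed.

Lemma diff_classZl (W : normedModType R) m U (f : V -> R) (w : W) :
  open U -> diff_class m U f -> diff_class m U (fun x => f x *: w).
Proof.
move=> Uo; elim: m f => [|m IH] f /=.
  by move=> fc x Ux; apply: cvgZr_tmp; exact: fc.
move=> [df Df]; split=> [x Ux|v]; first by apply: differentiableZl; exact: df.
apply: diff_class_eq (IH _ (Df v)) => // x Ux.
have dfx := df _ Ux; rewrite deriveE // [RHS]deriveE; last exact: differentiableZl.
by rewrite diffZl.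
Qed.

Lemma diff_class_rowP k m U (f : V -> 'rV[R]_k) : open U ->
  diff_class m U f <-> forall j, diff_class m U (fun x => f x 0 j).
Proof.
move=> Uo; split=> [|fj]; last first.
  rewrite (_ : f = \sum_j (fun x => f x 0 j *: (delta_mx 0 j : 'rV[R]_k))).
    by apply: diff_class_sum => // j; exact: diff_classZl.
  by apply/funext => x; rewrite fct_sumE [LHS]row_sum_delta.
elim: m f => [|m IH] f.
  move=> fc j x Ux.
  apply: (@continuous_comp _ _ _ f (fun N : 'rV_k => N 0 j)); first exact: fc.
  exact: coord_continuous.
move=> [df Df] j; split=> [x Ux|v].
  apply: (@differentiable_comp _ _ _ _ f (fun N : 'rV_k => N 0 j)).
    exact: df.
  exact: differentiable_coord.
have /(_ j) := IH _ (Df v); apply: diff_class_eq => // x Ux.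
by rewrite derive_mx ?mxE //; apply: diff_derivable; exact: df.
Qed.

End diff_class.

Lemma diff_class_coord (R : realType) m N (U : set 'rV[R]_N) j :
  open U -> diff_class m U (fun y : 'rV[R]_N => y 0 j).
Proof.
move=> Uo; have : diff_class m U (idfun : {linear 'rV[R]_N -> 'rV[R]_N}).
  by apply: diff_class_linear => x; exact: cvg_id.
by move/diff_class_rowP; apply.
Qed.

(** * The Laplacian of a radial function in coordinates *)

(** The metric G enters only through the hypotheses of this section: its
    determinant is constant along the fibers, and it sends the vector w with
    components (0, u) to half the differential of the function r. Then w is half
    the gradient of r and r is its squared length. *)
Section radial.
Variables (R : realType) (n k : nat).
Variables (G : 'rV[R]_(n + k) -> 'M[R]_(n + k)) (O : set 'rV[R]_(n + k)).
Variables (rho : 'rV[R]_n -> R) (r f : 'rV[R]_(n + k) -> R) (a b c : R -> R).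
Let w (y : 'rV[R]_(n + k)) : 'cV[R]_(n + k) := col_mx 0 (rsubmx y)^T.

Hypothesis O_open : open O.
Hypothesis detG : forall y, O y -> \det (G y) = rho (lsubmx y).
Hypothesis rho_gt0 : forall y, O y -> 0 < rho (lsubmx y).
Hypothesis dr : forall y, O y -> forall j,
  is_derive y (delta_mx 0 j) r (2 * (G y *m w y) j 0).
Hypothesis rE : forall y, O y -> r y = ((w y)^T *m G y *m w y) 0 0.
Hypothesis fE : forall y, O y -> f y = a (r y).
Hypothesis da : forall y, O y -> is_derive (r y) 1 a (b (r y)).
Hypothesis db : forall y, O y -> is_derive (r y) 1 b (c (r y)).

Lemma grad_radial y i : O y ->
  \sum_j invmx (G y) i j * 'D_(delta_mx 0 j : 'rV[R]_(n + k)) f y =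
  2 * b (r y) * w y i 0.
Proof.
move=> Oy.
have df j : 'D_(delta_mx 0 j : 'rV[R]_(n + k)) f y = 2 * b (r y) * (G y *m w y) j 0.
  rewrite (_ : 'D_(_) f y = 'D_(delta_mx 0 j : 'rV[R]_(n + k)) (a \o r) y).
    have [_ ->] := is_derive_comp1 (dr Oy j) (da Oy); ring.
  by apply: near_eq_derive; apply: filterS (open_nbhs_nbhs (conj O_open Oy)) => x /fE.
transitivity ((invmx (G y) *m (2 * b (r y) *: (G y *m w y))) i 0).
  by rewrite mxE; apply: eq_bigr => j _; rewrite df [in RHS]mxE.
have Gy : G y \in unitmx by rewrite unitmxE unitfE detG // gt_eqF // rho_gt0.
by rewrite -scalemxAr mulKmx // mxE.
Qed.

(** The gradient of f = a(r) is 2 a'(r) w. Its base components vanish, and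
    sqrt (det G) factors out of the derivatives of the fiber components; what
    remains is the divergence of u |-> 2 a'(r) u, in which the derivative of r
    along w contributes 2 r. *)
Lemma coord_laplacian_radial z : O z ->
  coord_laplacian G f z = 4 * r z * c (r z) + 2 * k%:R * b (r z).
Proof.
move=> Oz; rewrite /coord_laplacian.
pose q := Num.sqrt (rho (lsubmx z)).
pose I i y := Num.sqrt (\det (G y)) *
  \sum_(j < n + k) invmx (G y) i j * 'D_(delta_mx 0 j : 'rV[R]_(n + k)) f y.
have IE i y : O y -> I i y = Num.sqrt (rho (lsubmx y)) * (2 * b (r y) * w y i 0).
  by move=> Oy; rewrite /I detG // grad_radial.
rewrite big_split_ord /= big1 ?add0r => [|i _]; last first.
  rewrite -[RHS](derive_cst (0 : R) z (delta_mx 0 (lshift k i) : 'rV[R]_(n + k))).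
  apply: near_eq_derive; apply: filterS (open_nbhs_nbhs (conj O_open Oz)) => y Oy.
  by rewrite -/(I _ y) IE // /w col_mxEu mxE !mulr0.
have dI (j : 'I_k) : 'D_(delta_mx 0 (rshift n j) : 'rV[R]_(n + k)) (I (rshift n j)) z
    = 2 * q * (b (r z) + 2 * c (r z) * (w z (rshift n j) 0 * (G z *m w z) (rshift n j) 0)).
  set v : 'rV[R]_(n + k) := delta_mx 0 (rshift n j).
  have vE : v = row_mx 0 (delta_mx 0 j) by exact: delta_rshift.
  pose J y := 2 * q * (b (r y) * rsubmx y 0 j).
  (* I agrees with J only on the line through z along v, where the density is
     constant; this is enough for the derivatives along v to agree. *)
  transitivity ('D_v J z).
    rewrite derive_line [RHS]derive_line; apply: near_eq_derive.
    apply: filterS (near_line v (open_nbhs_nbhs (conj O_open Oz))) => s Os.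
    rewrite IE // /J /w col_mxEd [(_^T) j 0]mxE.
    rewrite (_ : lsubmx _ = lsubmx z); first by rewrite -/q; ring.
    by rewrite linearD linearZ /= vE row_mxKl scaler0 add0r.
  have dru : is_derive z v (fun y : 'rV[R]_(n + k) => rsubmx y 0 j) 1.
    apply/is_derive_line; rewrite (_ : (fun s => _) = fun s : R => s *: 1 + rsubmx z 0 j).
      exact: is_derive_affine_line.
    apply/funext => s; rewrite linearD linearZ /= vE row_mxKr !mxE !eqxx /=.
    by rewrite /GRing.scale /= mulr1.
  have dbr := is_derive_comp1 (dr Oz (rshift n j)) (db Oz).
  have -> : J = (2 * q) \*o ((b \o r) * (fun y => rsubmx y 0 j)) by [].
  rewrite derive_val /GRing.scale /= /w col_mxEd [(_^T) j 0]mxE.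
  ring.
rewrite (eq_bigr _ (fun j _ => dI j)) -mulr_sumr big_split /= -mulr_sumr.
have -> : \sum_(j < k) w z (rshift n j) 0 * (G z *m w z) (rshift n j) 0 = r z.
  rewrite rE // -mulmxA mxE big_split_ord /= [X in X + _]big1 ?add0r => [|j _].
    by apply: eq_bigr => j _; rewrite [(_^T) 0 _]mxE.
  by rewrite [(_^T) 0 _]mxE /w col_mxEu mxE mul0r.
have q0 : q != 0 by rewrite /q gt_eqF // sqrtr_gt0 rho_gt0.
by rewrite sumr_const card_ord detG // -/q -mulr_natl; field.
Qed.

End radial.

(** The derivative of the Laplacian 4 s f' + m f (with f = a' and m = 2 k) has the
    same shape, with m replaced by m + 4. *)
Lemma is_derive_radial_laplacian (R : realType) (f f' : R -> R) (m x f2 : R) :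
  is_derive x 1 f (f' x) -> is_derive x 1 f' f2 ->
  is_derive x 1 (fun s => 4 * s * f' s + m * f s) (4 * x * f2 + (m + 4) * f' x).
Proof.
move=> df df'; rewrite (_ : (fun s => _) = (4 \*o id) * f' + (m \*o f)) //.
by apply: is_derive_eq; rewrite /GRing.scale /=; ring.
Qed.

(** * Derivatives on the half-line and Euler equations *)

Section halfline.
Context {R : realType}.
Implicit Types (a b w : R -> R) (r s : R).

Lemma is_derive_halfline a r : 0 < r -> cvg (halfline_quotient a r) ->
  is_derive r 1 a (halfline_derive a r).
Proof.
move=> r0 qcvg.
suff lim_a : h^-1 *: ((a \o shift r) (h *: 1) - a r) @[h --> 0^'] --> halfline_derive a r.
  by split; [apply/cvg_ex; exists (halfline_derive a r)|exact/cvg_lim].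
rewrite /halfline_derive.
have shift_cvg : h + r @[h --> 0^'] --> within [set s | 0 <= s] r^'.
  move=> P; rewrite /within /= => rP.
  have rP' : \forall s \near r, s != r -> 0 <= s -> P s by exact: rP.
  have hP : \forall h \near 0, (h + r) != r -> 0 <= h + r -> P (h + r).
    by move: rP'; rewrite (near_shift 0 r) subr0.
  have h0 : \forall h \near (0 : R), 0 <= h + r.
    near=> h; rewrite -lerBlDr sub0r ltW //; near: h; apply: lt_nbhsr.
    by rewrite oppr_lt0.
  change (\forall h \near (0 : R), h != 0 -> P (h + r)).
  by apply: filterS2 hP h0 => h hP h0 h_neq0; apply: hP => //; rewrite -subr_eq0 addrK.
have := cvg_comp _ _ shift_cvg qcvg; apply: cvg_trans; apply: near_eq_cvg.
by near=> h; rewrite /= addrK [_%:A]mulr1 mulrC.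
Unshelve. all: by end_near. Qed.

Lemma at_right_halfline a : cvg (halfline_quotient a 0) -> a s @[s --> 0^'+] --> a 0.
Proof.
move=> qcvg.
have sub : (0 : R)^'+ `=>` within [set s : R | 0 <= s] 0^'.
  move=> P P0; change (\forall s \near (0 : R), 0 < s -> P s).
  have {}P0 : \forall s \near (0 : R), s != 0 -> 0 <= s -> P s by exact: P0.
  by apply: filterS P0 => s P0 s0; apply: P0; rewrite ?gt_eqF // ltW.
have lim0 : (a s - a 0) / (s - 0) * s + a 0 @[s --> 0^'+]
    --> halfline_derive a 0 * 0 + a 0.
  apply: cvgD; last exact: cvg_cst.
  apply: cvgM; first exact: cvg_trans (cvg_app _ sub) qcvg.
  by apply: cvg_at_right_filter; exact: cvg_id.
rewrite mulr0 add0r in lim0.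
apply: cvg_trans lim0; apply: near_eq_cvg; near=> s.
by rewrite subr0 divfK ?subrK // gt_eqF.
Unshelve. all: by end_near. Qed.

Lemma is_derive0_pos_cst a r s : (forall x : R, 0 < x -> is_derive x 1 a 0) ->
  0 < r -> 0 < s -> a r = a s.
Proof.
move=> da; wlog rs : r s / r <= s.
  by move=> H r0 s0; case/orP: (le_total r s) => ?; [|apply/esym]; exact: H.
move=> r0 s0; apply/esym/eqP; rewrite -subr_eq0; apply/eqP.
have ad x : x \in `]r, s[%R -> is_derive x 1 a 0.
  by rewrite in_itv /= => /andP[rx _]; apply: da; exact: lt_trans rx.
have ac : {within `[r, s], continuous a}.
  apply: derivable_within_continuous => x; rewrite in_itv /= => /andP[rx _].
  by have [] := da x (lt_le_trans r0 rx).
by have [x _ ->] := MVT_segment rs ad ac; rewrite mul0r.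
Qed.

(** The solutions are the multiples of r^(- m / c); to stay with integral
    exponents, note that r^m w^c is constant. It tends to 0 at 0 because w has a
    limit there and m > 0. *)
Lemma euler_eq0 (c m : nat) w w' (l : R) : (0 < c)%N -> (0 < m)%N ->
  (forall r, 0 < r -> is_derive r 1 w (w' r)) ->
  (forall r, 0 < r -> c%:R * r * w' r + m%:R * w r = 0) ->
  w s @[s --> 0^'+] --> l ->
  forall r, 0 < r -> w r = 0.
Proof.
move=> c0 m0 dw eqw wl r r0.
pose f s : R := s ^+ m * w s ^+ c.
have df s : 0 < s -> is_derive s 1 f 0.
  move=> s0; have ws := dw s s0.
  have fE : f = (id ^+ m) * (w ^+ c) by apply/funext => x; rewrite /f !fctE.
  rewrite fE; apply: is_derive_eq; rewrite !fctE /GRing.scale /= mulr1.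
  move: (eqw s s0) c0 m0; case: (c) (m) => [//|c'] [//|m'] e _ _ /=.
  rewrite !exprS.
  rewrite [LHS](_ : _ = s ^+ m' * w s ^+ c' * (c'.+1%:R * s * w' s + m'.+1%:R * w s)); last ring.
  by rewrite e mulr0.
have f0 : f s @[s --> 0^'+] --> (0 : R).
  have lm : s ^+ m @[s --> 0^'+] --> (0 ^+ m : R).
    exact: (cvg_at_right_filter (@exprn_continuous R m 0)).
  have lw : w s ^+ c @[s --> 0^'+] --> l ^+ c.
    exact: (cvg_comp _ _ wl (@exprn_continuous _ c l)).
  have E : 0 ^+ m * l ^+ c = 0 by rewrite expr0n gtn_eqF //= mul0r.
  by rewrite -[X in _ --> X]E; exact: cvgM lm lw.
have f_cst : f s @[s --> 0^'+] --> f r.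
  apply: cvg_near_cst; near=> s.
  by apply: is_derive0_pos_cst => //; near: s; exact: nbhs_right_gt.
have /eqP : f r = 0 by apply: cvg_unique f_cst f0.
by rewrite mulf_eq0 !expf_eq0 (gt_eqF r0) andbF /= => /andP[_ /eqP].
Unshelve. all: by end_near. Qed.

(** The left-hand side factors as (2 r d/dr + k + 2) (c r d/dr + k) f, so two
    applications of [euler_eq0] give f = 0. With f = alpha'', the case c = 2 is
    the biharmonic equation and c = 1 the equation of the theorem. *)
Lemma euler2_eq0 (c k : nat) (f f1 f2 : R -> R) (l l1 : R) : (0 < c)%N -> (0 < k)%N ->
  (forall r : R, 0 < r -> is_derive r 1 f (f1 r)) ->
  (forall r : R, 0 < r -> is_derive r 1 f1 (f2 r)) ->
  f s @[s --> 0^'+] --> l -> f1 s @[s --> 0^'+] --> l1 ->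
  (forall r : R, 0 < r -> 2 * c%:R * r ^+ 2 * f2 r +
     ((2 * c + 2 * k + (k + 2) * c)%N)%:R * r * f1 r + (k * (k + 2))%:R * f r = 0) ->
  forall r, 0 < r -> f r = 0.
Proof.
move=> c0 k0 df df1 fl f1l ode.
pose w r := c%:R * r * f1 r + k%:R * f r.
pose w' r := c%:R * f1 r + c%:R * r * f2 r + k%:R * f1 r.
have w0 : forall r, 0 < r -> w r = 0.
  apply: (@euler_eq0 2 (k + 2) w w' (c%:R * 0 * l1 + k%:R * l)) => //.
  - by rewrite addn2.
  - move=> r r0; have fr := df r r0; have f1r := df1 r r0.
    have wE : w = (c%:R \*o id) * f1 + (k%:R \*o f) by apply/funext.
    rewrite wE; apply: is_derive_eq.
    rewrite /w' /GRing.scale /=; ring.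
  - by move=> r r0; rewrite -[RHS](ode r r0) /w /w' !natrD !natrM !natrD; ring.
  - apply: cvgD; last by apply: cvgM => //; exact: cvg_cst.
    apply: cvgM => //; apply: cvgM; first exact: cvg_cst.
    by apply: cvg_at_right_filter; exact: cvg_id.
by apply: (@euler_eq0 c k f f1 l).
Qed.

Section smooth.
Variable a : R -> R.
Hypothesis a_smooth : smooth_halfline a.
Let d j := halfline_deriven j a.

Lemma is_derive_halfline_deriven j r : 0 < r -> is_derive r 1 (d j) (d j.+1 r).
Proof. by move=> r0; apply: is_derive_halfline => //; apply: a_smooth; exact: ltW. Qed.

Lemma at_right_halfline_deriven j : d j s @[s --> 0^'+] --> d j 0.
Proof. by apply: at_right_halfline; exact: a_smooth. Qed.

Lemma halfline_deriven2_eq0 (c k : nat) : (0 < c)%N -> (0 < k)%N ->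
  (forall r : R, 0 < r -> 2 * c%:R * r ^+ 2 * d 4 r +
     ((2 * c + 2 * k + (k + 2) * c)%N)%:R * r * d 3 r + (k * (k + 2))%:R * d 2 r = 0) ->
  forall r, 0 < r -> d 2 r = 0.
Proof.
move=> c0 k0; apply: euler2_eq0 => //; try exact: at_right_halfline_deriven.
all: exact: is_derive_halfline_deriven.
Qed.

Hypothesis d2_eq0 : forall r, 0 < r -> d 2 r = 0.

Lemma halfline_derivenS_eq0 j : (forall r, 0 < r -> d j r = 0) ->
  forall r, 0 < r -> d j.+1 r = 0.
Proof.
move=> dj0 r r0; have [_ <-] := is_derive_halfline_deriven j r0.
rewrite -[RHS](derive_cst (0 : R) r (1 : R)); apply: near_eq_derive.
by apply: filterS (lt_nbhsr r0) => s /dj0.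
Qed.

(** The value at 0 is a limit of values at r > 0, since a function with a right
    derivative at 0 is right-continuous there. *)
Lemma halfline_deriven2_at0 : d 2 0 = 0.
Proof.
apply: (cvg_unique _ (@at_right_halfline_deriven 2)) => //=.
by apply: cvg_near_cst; near=> s; apply: d2_eq0; near: s; exact: nbhs_right_gt.
Unshelve. all: by end_near. Qed.

Lemma halfline_affine : exists b0 b1 : R, forall r, 0 <= r -> a r = b0 + b1 * r.
Proof.
pose b1 := d 1 1; pose b0 := a 1 - b1.
have d1 r : 0 < r -> d 1 r = b1.
  move=> r0; apply: is_derive0_pos_cst => // x x0.
  by rewrite -(d2_eq0 x0); exact: is_derive_halfline_deriven.
have pos r : 0 < r -> a r = b0 + b1 * r.
  move=> r0; suff : a r - b1 * r = a 1 - b1 * 1 by rewrite /b0; lra.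
  apply: (@is_derive0_pos_cst (fun x => a x - b1 * x)) => // x x0.
  have ax : is_derive x 1 a b1 by rewrite -(d1 x x0); exact: (@is_derive_halfline_deriven 0).
  rewrite (_ : (fun y => _) = a - (b1 \*o id)) //; apply: is_derive_eq.
  by rewrite /GRing.scale /= mulr1 subrr.
exists b0, b1 => r; rewrite le_eqVlt => /orP[/eqP <-|]; last exact: pos.
have a0 := @at_right_halfline_deriven 0; apply: (cvg_unique _ a0) => //=.
have : b0 + b1 * s @[s --> (0 : R)^'+] --> b0 + b1 * 0.
  apply: cvg_at_right_filter; apply: cvgD; first exact: cvg_cst.
  by apply: cvgM; [exact: cvg_cst|exact: cvg_id].
apply: cvg_trans; apply: near_eq_cvg; near=> s.
by rewrite [RHS]pos //; near: s; exact: nbhs_right_gt.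
Unshelve. all: by end_near. Qed.

End smooth.
End halfline.

(** * Change of charts *)

Section chart.
Variables (R : realType) (n : nat) (M : topologicalType) (A : manifold R n M).
Implicit Types (c : chart R M n) (U : set M).

Lemma open_chart_image c U : atlas A c -> open U -> open (cmap c @` (cdom c `&` U)).
Proof.
move=> /atlas_homeo[cdo cio cK _ ci] Uo; rewrite openE => x [p [cp Up] <-].
have px : (cmap c @` cdom c) (cmap c p) by exists p.
have Ux : nbhs (cinv c (cmap c p)) U by rewrite cK //; exact: open_nbhs_nbhs.
apply: filterS2 (open_nbhs_nbhs (conj cio px)) (ci _ px _ Ux).
by move=> y /= [q cq <-]; rewrite cK // => Uq; exists q.
Qed.

Lemma chart_image_inv c U x : atlas A c -> (cmap c @` (cdom c `&` U)) x ->
  [/\ cdom c (cinv c x), U (cinv c x) & cmap c (cinv c x) = x].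
Proof. by move=> /atlas_homeo[_ _ cK _ _] [p [cp Up] <-]; rewrite cK. Qed.

Lemma near_chart c U p : atlas A c -> cdom c p -> open U -> U p ->
  \forall x \near cmap c p,
    [/\ cdom c (cinv c x), U (cinv c x) & cmap c (cinv c x) = x].
Proof.
move=> Ac cp Uo Up.
have px : (cmap c @` (cdom c `&` U)) (cmap c p) by exists p.
apply: filterS (open_nbhs_nbhs (conj (open_chart_image Ac Uo) px)) => x.
exact: chart_image_inv.
Qed.

Lemma smooth_fun_sub (W : normedModType R) U U' (f : M -> W) :
  U' `<=` U -> smooth_fun (atlas A) U f -> smooth_fun (atlas A) U' f.
Proof.
move=> U'U sf c Ac m; apply: diff_class_sub (sf c Ac m).
by apply: image_subset; exact: setIS.
Qed.

Lemma smooth_fun_eq (W : normedModType R) U (f g : M -> W) :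
  open U -> (forall p, U p -> f p = g p) ->
  smooth_fun (atlas A) U f -> smooth_fun (atlas A) U g.
Proof.
move=> Uo fg sf c Ac m; apply: diff_class_eq (sf c Ac m).
  exact: open_chart_image.
by move=> x /(chart_image_inv Ac)[_ Ux _]; exact: fg.
Qed.

Lemma smooth_fun_cst (W : normedModType R) U (a : W) :
  smooth_fun (atlas A) U (cst a).
Proof. by move=> c Ac m; exact: diff_class_cst. Qed.

Lemma smooth_funD (W : normedModType R) U (f g : M -> W) : open U ->
  smooth_fun (atlas A) U f -> smooth_fun (atlas A) U g ->
  smooth_fun (atlas A) U (f + g).
Proof.
move=> Uo sf sg c Ac m; apply: (diff_classD _ (sf c Ac m) (sg c Ac m)).
exact: open_chart_image.
Qed.

Lemma smooth_funM U (f g : M -> R) : open U ->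
  smooth_fun (atlas A) U f -> smooth_fun (atlas A) U g ->
  smooth_fun (atlas A) U (f * g).
Proof.
move=> Uo sf sg c Ac m; apply: (diff_classM _ (sf c Ac m) (sg c Ac m)).
exact: open_chart_image.
Qed.

Lemma smooth_fun_sum (W : normedModType R) U m (f : 'I_m -> M -> W) : open U ->
  (forall i, smooth_fun (atlas A) U (f i)) ->
  smooth_fun (atlas A) U (fun p => \sum_i f i p).
Proof.
move=> Uo sf; rewrite (_ : (fun p => _) = \sum_i f i); last first.
  by apply/funext => p; rewrite fct_sumE.
apply: (big_ind (smooth_fun (atlas A) U)) => //; first exact: smooth_fun_cst.
by move=> f1 f2; exact: smooth_funD.
Qed.

Lemma smooth_fun_rowP k U (f : M -> 'rV[R]_k) : open U ->
  smooth_fun (atlas A) U f <-> forall j, smooth_fun (atlas A) U (fun p => f p 0 j).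
Proof.
move=> Uo; split=> [sf j c Ac m|sf c Ac m].
  by apply: (diff_class_rowP _ _ _).1 (sf c Ac m) j; exact: open_chart_image.
apply/diff_class_rowP; first exact: open_chart_image.
by move=> j; exact: sf.
Qed.

Lemma smooth_fun_differentiable (W : normedModType R) U (f : M -> W) c p :
  atlas A c -> cdom c p -> U p -> smooth_fun (atlas A) U f ->
  differentiable (f \o cinv c) (cmap c p).
Proof. by move=> Ac cp Up /(_ c Ac 1%N)[df _]; apply: df; exists p. Qed.

Lemma smooth_fun_chart c : atlas A c -> smooth_fun (atlas A) (cdom c) (cmap c).
Proof. by move=> Ac c' Ac'; exact: (atlas_smooth Ac' Ac). Qed.

(** Chain rule for f = (f o c'^-1) o (c' o c^-1). With c' the chart that is used
    to represent tangent vectors at p, and v a basis vector, it says that the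
    derivative of f along the coordinate vector of c is the partial derivative
    of f in c. *)
Lemma chart_derive_change (W : normedModType R) U (f : M -> W) c c' p
    (v : 'rV[R]_n) :
  atlas A c -> atlas A c' -> cdom c p -> cdom c' p -> U p ->
  smooth_fun (atlas A) U f ->
  'D_v (f \o cinv c) (cmap c p) =
  'D_('D_v (cmap c' \o cinv c) (cmap c p)) (f \o cinv c') (cmap c' p).
Proof.
move=> Ac Ac' cp c'p Up sf.
have [_ _ cK _ _] := atlas_homeo Ac; have [c'o _ c'K _ _] := atlas_homeo Ac'.
have cmapE : (cmap c' \o cinv c) (cmap c p) = cmap c' p by rewrite /= cK.
rewrite -cmapE -derive_comp.
- apply: near_eq_derive; apply: filterS (near_chart Ac cp c'o c'p) => x [_ c'x _] /=.
  by rewrite c'K.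
- exact: smooth_fun_differentiable (smooth_fun_chart Ac').
- by rewrite cmapE; exact: smooth_fun_differentiable sf.
Qed.

(** Apply the change of charts to f = c itself: the derivative of a transition
    map has the derivative of the inverse transition as a left inverse. *)
Lemma transition_derive_eq0 c c' p (v : 'rV[R]_n) :
  atlas A c -> atlas A c' -> cdom c p -> cdom c' p ->
  'D_v (cmap c' \o cinv c) (cmap c p) = 0 -> v = 0.
Proof.
move=> Ac Ac' cp c'p D0.
have := chart_derive_change v Ac Ac' cp c'p cp (smooth_fun_chart Ac).
rewrite D0 derive0 => <-; rewrite -[LHS](derive_id (cmap c p) v).
have [co _ _ _ _] := atlas_homeo Ac.
by apply: near_eq_derive; apply: filterS (near_chart Ac cp co cp) => x [].
Qed.

End chart.

(** * Sections and connections *)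

Section bundle.
Variables (R : realType) (n k : nat) (M : topologicalType) (A : manifold R n M).
Variables (V : M -> lmodType R) (B : vector_bundle A V k).
Implicit Types (U : set M) (s : forall p, V p) (t : trivialization V k)
  (c : chart R M n) (p : M).

Section fiberwise.
Variables (t : trivialization V k) (p : M).
Hypotheses (Bt : trivs B t) (tp : tdom t p).

Lemma tcoordK : cancel (tcoord t (p := p)) (tinv t p).
Proof. by case: (trivs_linear Bt) => _ _ + _; apply. Qed.

Lemma tinvK : cancel (tinv t p) (tcoord t (p := p)).
Proof. by case: (trivs_linear Bt) => _ _ _; apply. Qed.

Lemma tcoord_linear : linear (tcoord t (p := p)).
Proof. by case: (trivs_linear Bt) => _ + _ _; apply. Qed.

Lemma tcoordD (v w : V p) : tcoord t (v + w) = tcoord t v + tcoord t w :> 'rV_k.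
Proof. by have := tcoord_linear 1 v w; rewrite !scale1r. Qed.

Lemma tcoord0 : tcoord t (0 : V p) = 0.
Proof. by apply/eqP; have /eqP := tcoordD 0 0; rewrite addr0 -subr_eq0 opprD addNKr oppr_eq0 . Qed.

Lemma tcoordZ a (v : V p) : tcoord t (a *: v) = a *: tcoord t v :> 'rV_k.
Proof. by rewrite -[a *: v]addr0 tcoord_linear tcoord0 addr0. Qed.

Lemma tinvD x y : tinv t p (x + y) = tinv t p x + tinv t p y.
Proof. by apply: (can_inj tcoordK); rewrite tcoordD !tinvK. Qed.

Lemma tinvZ a x : tinv t p (a *: x) = a *: tinv t p x.
Proof. by apply: (can_inj tcoordK); rewrite tcoordZ !tinvK. Qed.

Lemma tinv_sum (x : 'rV[R]_k) : tinv t p x = \sum_a x 0 a *: tinv t p (delta_mx 0 a).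
Proof.
rewrite [in LHS](row_sum_delta x) (big_morph (tinv t p) tinvD (id1 := 0)).
  by apply: eq_bigr => a _; rewrite tinvZ.
by apply: (can_inj tcoordK); rewrite tinvK tcoord0.
Qed.

End fiberwise.

Definition frame t (u : 'rV[R]_k) : forall p, V p := fun p => tinv t p u.

Lemma tdom_open t : trivs B t -> open (tdom t).
Proof. by case/trivs_linear. Qed.

Lemma smooth_section_sub U U' s : U' `<=` U ->
  smooth_section B U s -> smooth_section B U' s.
Proof. by move=> U'U ss t Bt; apply: smooth_fun_sub (ss t Bt); exact: setSI. Qed.

Lemma smooth_sectionD U s s' : open U ->
  smooth_section B U s -> smooth_section B U s' ->
  smooth_section B U (fun p => s p + s' p).
Proof.
move=> Uo ss ss' t Bt; have UtO := openI Uo (tdom_open Bt).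
apply: smooth_fun_eq (smooth_funD UtO (ss t Bt) (ss' t Bt)) => // p [_ tp].
by rewrite (tcoordD Bt).
Qed.

Lemma smooth_sectionZ U (f : M -> R) s : open U ->
  smooth_fun (atlas A) U f -> smooth_section B U s ->
  smooth_section B U (fun p => f p *: s p).
Proof.
move=> Uo sf ss t Bt; have UtO := openI Uo (tdom_open Bt).
apply/smooth_fun_rowP => // j; have /smooth_fun_rowP/(_ j) ssj := ss t Bt.
have sft : smooth_fun (atlas A) (U `&` tdom t) f by apply: smooth_fun_sub sf.
apply: smooth_fun_eq (smooth_funM UtO sft (ssj UtO)) => // p [_ tp].
by rewrite (tcoordZ Bt) // mxE.
Qed.

Lemma smooth_section_frame t u : trivs B t -> smooth_section B (tdom t) (frame t u).
Proof. by move=> Bt t' Bt'; exact: (trivs_smooth Bt Bt' u). Qed.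

Lemma smooth_section_near_frame t u p : trivs B t -> tdom t p ->
  smooth_section_near B p (frame t u).
Proof.
by move=> Bt tp; exists (tdom t); split=> //; [exact: tdom_open|exact: smooth_section_frame].
Qed.

Lemma smooth_section_near0 p : smooth_section_near B p (fun=> 0).
Proof.
exists setT; split=> //; first exact: openT.
move=> t Bt; apply: smooth_fun_eq (@smooth_fun_cst _ _ _ A _ (setT `&` tdom t) (0 : 'rV_k)).
  by rewrite setTI; exact: tdom_open.
by move=> q [_ tq]; rewrite (tcoord0 Bt).
Qed.

Lemma smooth_section_nearD p s s' :
  smooth_section_near B p s -> smooth_section_near B p s' ->
  smooth_section_near B p (fun p => s p + s' p).
Proof.
move=> [U [Uo Up ss]] [U' [U'o U'p ss']]; exists (U `&` U'); split=> //.
  exact: openI.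
apply: smooth_sectionD; first exact: openI.
  by apply: smooth_section_sub ss; exact: subIsetl.
by apply: smooth_section_sub ss'; exact: subIsetr.
Qed.

Lemma smooth_section_nearZ p (f : M -> R) s :
  smooth_near A p f -> smooth_section_near B p s ->
  smooth_section_near B p (fun p => f p *: s p).
Proof.
move=> [U [Uo Up sf]] [U' [U'o U'p ss]]; exists (U `&` U'); split=> //.
  exact: openI.
apply: smooth_sectionZ; first exact: openI.
  by apply: smooth_fun_sub sf; exact: subIsetl.
by apply: smooth_section_sub ss; exact: subIsetr.
Qed.

Section connection.
Variable D : forall p, tangent (chart_at A) p -> (forall q, V q) -> V p.
Hypothesis DP : connection B D.
Variables (p : M) (v : tangent (chart_at A) p).

Lemma connection0 : D v (fun=> 0) = 0.
Proof.
have [_ Dadd _ _] := DP; have s0 := smooth_section_near0 p.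
have := Dadd p v _ _ s0 s0.
rewrite (_ : (fun q => 0 + 0) = (fun q => 0 : V q)); last first.
  by apply: functional_extensionality_dep => q; rewrite addr0.
by move=> /eqP; rewrite -subr_eq0 opprD addNKr oppr_eq0 => /eqP.
Qed.

Lemma connection0l s : smooth_section_near B p s -> D (0 : tangent (chart_at A) p) s = 0.
Proof.
have [Dlin _ _ _] := DP; move=> ss.
have := Dlin p 1 0 0 s ss; rewrite scaler0 addr0 scale1r => /eqP.
by rewrite -subr_eq0 opprD addNKr oppr_eq0 => /eqP.
Qed.

(** Multiply both sections by the indicator function of U: the products are
    equal everywhere, and the Leibniz rule gives the same term in the derivative
    of this function for both, because s p = s' p. *)
Lemma connection_local U s s' : open U -> U p -> (forall q, U q -> s q = s' q) ->
  smooth_section_near B p s -> smooth_section_near B p s' -> D v s = D v s'.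
Proof.
move=> Uo Up ss'E ss ss'; have [_ _ Dleib _] := DP.
pose f (q : M) : R := if `[< U q >] then 1 else 0.
have f1 q : U q -> f q = 1 by move=> Uq; rewrite /f asboolT.
have sf : smooth_near A p f.
  exists U; split=> //.
  by apply: smooth_fun_eq (@smooth_fun_cst _ _ _ A _ U (1 : R)) => // q /f1.
have fss' : (fun q => f q *: s q) = (fun q => f q *: s' q).
  apply: functional_extensionality_dep => q; rewrite /f.
  by case: asboolP => [/ss'E ->//|_]; rewrite !scale0r.
have := Dleib p v f s sf ss; rewrite fss' Dleib // f1 // !scale1r ss'E //.
by move=> /addrI ->.
Qed.

Lemma connection_sum m (f : 'I_m -> M -> R) (s : 'I_m -> forall q, V q) :
  (forall i, smooth_near A p (f i)) -> (forall i, smooth_section_near B p (s i)) ->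
  smooth_section_near B p (fun q => \sum_i f i q *: s i q) /\
  D v (fun q => \sum_i f i q *: s i q) =
  \sum_i (tangent_derive v (f i) *: s i p + f i p *: D v (s i)).
Proof.
move=> sf ss; have [_ Dadd Dleib _] := DP.
elim: (index_enum 'I_m) => [|i l [sl Dl]].
  rewrite (_ : (fun q => _) = fun q => 0 : V q); last first.
    by apply: functional_extensionality_dep => q; rewrite big_nil.
  by rewrite big_nil; split; [exact: smooth_section_near0|exact: connection0].
rewrite (_ : (fun q => _) =
  fun q => f i q *: s i q + \sum_(j <- l) f j q *: s j q); last first.
  by apply: functional_extensionality_dep => q; rewrite big_cons.
have sfi := smooth_section_nearZ (sf i) (ss i).
split; first exact: smooth_section_nearD.
by rewrite big_cons Dadd // Dleib // Dl.
Qed.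

End connection.
End bundle.

(** * The Sasaki metric in bundle charts *)

Section sasaki.
Variables (R : realType) (n k : nat) (M : topologicalType) (A : manifold R n M).
Variables (V : M -> lmodType R) (B : vector_bundle A V k).
Variable g : forall p, tangent (chart_at A) p -> tangent (chart_at A) p -> R.
Variable h : forall p, V p -> V p -> R.
Variable D : forall p, tangent (chart_at A) p -> (forall q, V q) -> V p.
Hypothesis gP : riemannian_metric g.
Hypothesis hP : fiber_metric B h.
Hypothesis DP : connection B D.
Hypothesis Dh : metric_connection B h D.

(** Coefficients of a covariant derivative in the frame of a trivialization. It
    is applied to one section with constant coefficients and to one without, in
    order to change trivializations in [connection_map_lshift]. *)
Lemma connection_frame_coef t p (v : tangent (chart_at A) p) U (x : M -> 'rV[R]_k) s :
  trivs B t -> tdom t p -> open U -> U p -> smooth_fun (atlas A) U x ->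
  (forall q, U q -> tdom t q -> s q = tinv t q (x q)) ->
  smooth_section_near B p s ->
  D v s = \sum_a (tangent_derive v (fun q => x q 0 a) *: tinv t p (delta_mx 0 a) +
                  x p 0 a *: D v (frame t (delta_mx 0 a))).
Proof.
move=> Bt tp Uo Up sx sE ss.
have sxa a : smooth_near A p (fun q => x q 0 a).
  by exists U; split=> //; move/smooth_fun_rowP: sx; apply.
have sta a : smooth_section_near B p (frame t (delta_mx 0 a)).
  exact: smooth_section_near_frame.
have [ss' <-] := connection_sum DP v sxa sta.
apply: (connection_local DP v (U := U `&` tdom t)) => //.
  by apply: openI => //; exact: (tdom_open Bt).
by move=> q [Uq tq]; rewrite sE // (tinv_sum Bt).
Qed.

Section local.
Variables (c : chart R M n) (t : trivialization V k).
Hypotheses (Ac : atlas A c) (Bt : trivs B t).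

Definition fiber_gram p : 'M[R]_k := gram (@h p) (fun a => tinv t p (delta_mx 0 a)).

Lemma fiber_gramE p x y : tdom t p ->
  h (tinv t p x) (tinv t p y) = (x *m fiber_gram p *m y^T) 0 0.
Proof.
move=> tp; rewrite (tinv_sum Bt tp x) (tinv_sum Bt tp y).
by apply: inner_product_gram; case: hP.
Qed.

Lemma det_fiber_gram_gt0 p : tdom t p -> 0 < \det (fiber_gram p).
Proof.
move=> tp; apply: det_gram_gt0; first by case: hP.
move=> x; rewrite -(tinv_sum Bt tp) => /(congr1 (tcoord t (p := p))).
by rewrite (tinvK Bt) // (tcoord0 Bt).
Qed.

Definition base_gram p : 'M[R]_n :=
  gram (@g p) (fun i => coord_vec (chart_at A) c p i).

(** The coordinate fields of c are the images of the basis vectors under an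
    injective linear map, the derivative of the transition to the chart at p. *)
Lemma det_base_gram_gt0 p : cdom c p -> 0 < \det (base_gram p).
Proof.
move=> cp; apply: det_gram_gt0; first by case: gP.
have Ac' := chart_at_atlas A p; have c'p := chart_at_dom A p.
move=> x; have dtau : differentiable (cmap (chart_at A p) \o cinv c) (cmap c p).
  exact: smooth_fun_differentiable (smooth_fun_chart Ac').
move=> x0; apply: (transition_derive_eq0 Ac Ac' cp c'p).
rewrite deriveE // (row_sum_delta x) linear_sum -[RHS]x0; apply: eq_bigr => i _.
by rewrite linearZ /coord_vec deriveE.
Qed.

Lemma smooth_sq_norm_frame u :
  smooth_fun (atlas A) (tdom t) (fun p => h (frame t u p) (frame t u p)).
Proof.
have to := tdom_open Bt; have [_ sh] := hP.
have sH a b : smooth_fun (atlas A) (tdom t) (fun p => fiber_gram p a b).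
  by apply: smooth_fun_eq (sh t Bt a b) => // p tp; rewrite mxE.
have := smooth_fun_sum to (fun a => smooth_fun_sum to (fun b =>
  smooth_funM to (@smooth_fun_cst _ _ _ A _ (tdom t) (u 0 a * u 0 b)) (sH a b))).
apply: smooth_fun_eq => // p tp; rewrite /frame fiber_gramE //.
rewrite mxE exchange_big /=; apply: eq_bigr => b _.
rewrite [u^T _ _]mxE mxE mulr_suml; apply: eq_bigr => a _.
by rewrite !fctE mulrAC.
Qed.

Section point.
Variable e : Defs.total V.
Hypotheses (ce : cdom c (tag e)) (te : tdom t (tag e)).
Let p := tag e.
Let u : 'rV[R]_k := tcoord t (tagged e).
Let C := bundle_chart c t.
Let ecoord i := coord_vec (bundle_chart_at B) C e i.
Let t' := triv_at B p.
Let c' := chart_at A p.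
Let Ac' : atlas A c' := chart_at_atlas A p.
Let c'p : cdom c' p := chart_at_dom A p.
Let Bt' : trivs B t' := triv_at_trivs B p.
Let t'p : tdom t' p := triv_at_dom B p.
Let theta q : 'rV[R]_k := tcoord t' (tinv t q u).

Let cinvK : cinv c (cmap c p) = p.
Proof. by have [_ _ + _ _] := atlas_homeo Ac; apply. Qed.

Let smooth_theta : smooth_fun (atlas A) (tdom t `&` tdom t') theta.
Proof. exact: (trivs_smooth Bt Bt' u). Qed.

(** The second block does not vanish: constant coordinates in t are in general
    not constant in the trivialization chosen at p. *)
Lemma coord_vec_lshift i : ecoord (lshift k i) =
  row_mx (coord_vec (chart_at A) c p i)
         ('D_(delta_mx 0 i : 'rV_n) (theta \o cinv c) (cmap c p)).
Proof.
set v : 'rV[R]_n := delta_mx 0 i.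
have dchart : differentiable (cmap c' \o cinv c) (cmap c p).
  exact: smooth_fun_differentiable (smooth_fun_chart Ac').
have dtheta : differentiable (theta \o cinv c) (cmap c p).
  exact: smooth_fun_differentiable smooth_theta.
have /is_derive_line dl := is_derive_row_mx
  (derivableP (diff_derivable (v := v) dchart)) (derivableP (diff_derivable (v := v) dtheta)).
suff [_ <-] : is_derive (cmap C e) (delta_mx 0 (lshift k i) : 'rV_(n + k))
  (cmap (bundle_chart_at B e) \o cinv C)
  (row_mx ('D_v (cmap c' \o cinv c) (cmap c p)) ('D_v (theta \o cinv c) (cmap c p))) by [].
apply/is_derive_line; move: dl; congr (is_derive _ _ _ _).
apply/funext => s /=; rewrite delta_lshift row_mx_line scaler0 add0r.
by rewrite row_mxKl row_mxKr.
Qed.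

Lemma coord_vec_rshift a :
  ecoord (rshift n a) = row_mx 0 (tcoord t' (tinv t p (delta_mx 0 a))).
Proof.
suff [_ <-] : is_derive (cmap C e) (delta_mx 0 (rshift n a) : 'rV_(n + k))
  (cmap (bundle_chart_at B e) \o cinv C)
  (row_mx 0 (tcoord t' (tinv t p (delta_mx 0 a)))) by [].
apply/is_derive_line.
have := is_derive_affine_line (row_mx 0 (tcoord t' (tinv t p (delta_mx 0 a))))
  (row_mx (cmap c' p) (tcoord t' (tagged e)) : 'rV[R]_(n + k)).
congr (is_derive _ _ _ _).
apply/funext => s /=; rewrite delta_rshift !row_mx_line !scaler0 !add0r.
rewrite row_mxKl row_mxKr -/p cinvK; congr row_mx.
by rewrite (tinvD Bt) // (tinvZ Bt) // (tcoordD Bt') // (tcoordZ Bt') // (tcoordK Bt).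
Qed.

Lemma dproj_lshift i : dproj (ecoord (lshift k i)) = coord_vec (chart_at A) c p i.
Proof. by rewrite /dproj coord_vec_lshift row_mxKl. Qed.

Lemma dproj_rshift a : dproj (ecoord (rshift n a)) = 0.
Proof. by rewrite /dproj coord_vec_rshift row_mxKl. Qed.

(** The connection map is defined with the trivialization chosen at p. Expand
    [frame t u] in the frame of that one: the derivatives of its coefficients are
    the vertical part of the coordinate vector, and the rest is the covariant
    derivative of the section with constant coefficients. *)
Lemma connection_map_lshift i : connection_map D (ecoord (lshift k i)) =
  D (coord_vec (chart_at A) c p i) (frame t u).
Proof.
rewrite /connection_map dproj_lshift coord_vec_lshift row_mxKr -/p -/t'.
set v := coord_vec _ _ _ _.
have tt'o := openI (tdom_open Bt) (tdom_open Bt').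
have tt'p : (tdom t `&` tdom t') p by [].
rewrite (connection_frame_coef (s := frame t u) v Bt' t'p tt'o tt'p smooth_theta); first last.
- exact: smooth_section_near_frame.
- by move=> q _ t'q; rewrite (tcoordK Bt').
rewrite (connection_frame_coef v Bt' t'p (@openT M) I
  (@smooth_fun_cst _ _ _ A _ setT (tcoord t' (tagged e)))); first last.
- exact: smooth_section_near_frame.
- by [].
rewrite (tinv_sum Bt' t'p) -big_split; apply: eq_bigr => a _ /=.
rewrite addrC [theta p]/theta /u -/p (tcoordK Bt) //.
rewrite [tangent_derive v (fun _ => _)]derive_cst scale0r add0r; congr (_ *: _ + _).
have thetaa : smooth_fun (atlas A) (tdom t `&` tdom t') (fun q => theta q 0 a).
  by move/smooth_fun_rowP: smooth_theta; apply.
rewrite /tangent_derive -(chart_derive_change _ Ac Ac' ce c'p tt'p thetaa).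
rewrite derive_mx ?mxE //; apply: diff_derivable.
exact: smooth_fun_differentiable smooth_theta.
Qed.

Lemma connection_map_rshift a :
  connection_map D (ecoord (rshift n a)) = tinv t p (delta_mx 0 a).
Proof.
rewrite /connection_map dproj_rshift coord_vec_rshift row_mxKr -/p -/t'.
rewrite (connection0l DP) ?add0r ?(tcoordK Bt') //.
exact: smooth_section_near_frame.
Qed.

Definition covariant_frame : 'M[R]_(n, k) :=
  \matrix_i tcoord t (D (coord_vec (chart_at A) c p i) (frame t u)).

Lemma connection_map_ecoord i :
  connection_map D (ecoord i) = tinv t p (row i (col_mx covariant_frame 1%:M)).
Proof.
case: (split_ordP i) => i' ->.
  by rewrite rowKu rowK (tcoordK Bt) // connection_map_lshift.
by rewrite rowKd row1 connection_map_rshift.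
Qed.

Let sasaki := spherically_symmetric_metric B g h D (fun _ => 0) (fun _ => 0).

Lemma sasakiE (X Y : tangent (bundle_chart_at B) e) : sasaki X Y =
  g (dproj X) (dproj Y) + h (connection_map D X) (connection_map D Y).
Proof. by rewrite /sasaki /spherically_symmetric_metric mulr0 expR0 !mul1r. Qed.

Lemma sasaki_gramE :
  \matrix_(i, j) sasaki (ecoord i) (ecoord j) =
  block_mx (base_gram p) 0 0 0 +
  col_mx covariant_frame 1%:M *m fiber_gram p *m (col_mx covariant_frame 1%:M)^T.
Proof.
apply/matrixP => i j; rewrite [LHS]mxE sasakiE [RHS]mxE; congr (_ + _).
  have g0l X : g (0 : tangent (chart_at A) p) X = 0.
    by apply: inner_product0l; case: gP.
  have g0r X : g X (0 : tangent (chart_at A) p) = 0.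
    by rewrite inner_productC ?g0l //; case: gP.
  case: (split_ordP i) => i' ->; case: (split_ordP j) => j' ->.
  - by rewrite block_mxEul [RHS]mxE; congr (g _ _); exact: dproj_lshift.
  - rewrite block_mxEur [RHS]mxE -[RHS](g0r (dproj (ecoord (lshift k i')))).
    by congr (g _ _); exact: dproj_rshift.
  - rewrite block_mxEdl [RHS]mxE -[RHS](g0l (dproj (ecoord (lshift k j')))).
    by congr (g _ _); exact: dproj_rshift.
  - rewrite block_mxEdr [RHS]mxE -[RHS](g0l (dproj (ecoord (rshift n j')))).
    by congr (g _ _); exact: dproj_rshift.
transitivity (h (tinv t p (row i (col_mx covariant_frame 1%:M)))
                (tinv t p (row j (col_mx covariant_frame 1%:M)))).
  by congr (h _ _); exact: connection_map_ecoord.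
rewrite fiber_gramE // -row_mul [LHS]mxE [RHS]mxE; apply: eq_bigr => a _.
by rewrite [row _ _ _ _]mxE [_^T _ _]mxE [row _ _ _ _]mxE [_^T _ j]mxE.
Qed.

Lemma sq_norm_gram : sq_norm h e = (u *m fiber_gram p *m u^T) 0 0.
Proof. by rewrite -fiber_gramE // (tcoordK Bt). Qed.

(** Along the fiber r is a quadratic polynomial. Along the base, r is the squared
    norm of the section [frame t u], whose derivative is given by D h = 0. *)
Lemma is_derive_sq_norm j :
  is_derive (cmap C e) (delta_mx 0 j : 'rV_(n + k)) (sq_norm h \o cinv C)
    (2 * h (connection_map D (ecoord j)) (tagged e)).
Proof.
have [hip _] := hP.
have hC (x y : V p) : h x y = h y x by exact: inner_productC.
case: (split_ordP j) => j' ->.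
  rewrite connection_map_lshift; set v : 'rV[R]_n := delta_mx 0 j'.
  have su := smooth_sq_norm_frame u.
  have dsq := smooth_fun_differentiable Ac ce te su.
  have /is_derive_line := derivableP (diff_derivable (v := v) dsq).
  rewrite (chart_derive_change _ Ac Ac' ce c'p te su).
  have ssu : smooth_section_near B p (frame t u) by exact: smooth_section_near_frame.
  have /= := Dh (coord_vec (chart_at A) c p j') ssu ssu; rewrite /tangent_derive => ->.
  rewrite [h (frame t u p) _]hC [frame t u p]/frame /u (tcoordK Bt) // -mulr2n => dl.
  apply/is_derive_line; move: dl; congr (is_derive _ _ _ _); last by rewrite mulr_natl.
  apply/funext => s /=; rewrite delta_lshift row_mx_line scaler0 add0r.
  by rewrite /sq_norm /= row_mxKl row_mxKr.
rewrite connection_map_rshift; apply/is_derive_line.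
set w := tinv t p (delta_mx 0 j'); set x := tagged e.
have -> : (fun s : R => (sq_norm h \o cinv C)
    (s *: (delta_mx 0 (rshift n j') : 'rV_(n + k)) + cmap C e)) =
  horner ((h w w)%:P * 'X * 'X + (2 * h w x)%:P * 'X + (h x x)%:P).
  apply/funext => s /=; rewrite delta_rshift row_mx_line scaler0 add0r.
  rewrite /sq_norm /= row_mxKl row_mxKr -/p cinvK !hornerE.
  rewrite (tinvD Bt) // (tinvZ Bt) // -/w /u (tcoordK Bt) // -/x.
  rewrite !(inner_productDl (hip p)) !(inner_productZl (hip p)).
  rewrite [h w (_ + _)]hC [h x (_ + _)]hC !(inner_productDl (hip p)) !(inner_productZl (hip p)).
  rewrite [h x w]hC; ring.
apply: is_derive_eq; rewrite !poly.derivE !hornerE; ring.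
Qed.

End point.
End local.

Lemma bundle_chart_image (c : chart R M n) (t : trivialization V k) : trivs B t ->
  cmap (bundle_chart c t) @` (cdom (bundle_chart c t) `&` setT) =
  (lsubmx : 'rV[R]_(n + k) -> 'rV[R]_n) @^-1` (cmap c @` (cdom c `&` tdom t)).
Proof.
move=> Bt; apply/seteqP; split=> [z [[p v] [[/= cp tp] _] <-]|z [p [cp tp] pz]] /=.
  by rewrite row_mxKl; exists p.
exists (existT _ p (tinv t p (rsubmx z))) => //=.
by rewrite pz (tinvK Bt) // hsubmxK.
Qed.

Lemma smooth_sq_norm : smooth_fun (bundle_atlas B) setT (sq_norm h).
Proof.
move=> _ [c [t [Ac Bt ->]]] m; rewrite bundle_chart_image //.
have Oo := open_chart_image Ac (tdom_open Bt); set O := _ @` _ in Oo *.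
have LOo : open ((lsubmx : 'rV[R]_(n + k) -> 'rV[R]_n) @^-1` O).
  by apply: open_comp Oo => x _; exact: continuous_lsubmx.
have sH a b : diff_class m (lsubmx @^-1` O)
    ((fun x => fiber_gram t (cinv c x) a b) \o (lsubmx : 'rV[R]_(n + k) -> 'rV[R]_n)).
  have [_ sh] := hP.
  apply: (@diff_class_comp_linear _ _ _ _ _ _ (lsubmx : {linear 'rV[R]_(n + k) -> 'rV[R]_n}) _ Oo).
    exact: continuous_lsubmx.
  apply: diff_class_eq (sh t Bt a b c Ac m); first exact: Oo.
  by move=> x _; rewrite mxE.
have su a : diff_class m (lsubmx @^-1` O) (fun y : 'rV[R]_(n + k) => y 0 (rshift n a)).
  exact: diff_class_coord.
have := diff_class_sum LOo (fun b => diff_class_sum LOo (fun a =>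
  diff_classM LOo (diff_classM LOo (su a) (sH a b)) (su b))).
apply: diff_class_eq => // z /(chart_image_inv Ac)[cz tz zE].
rewrite /= /sq_norm /= (fiber_gramE Bt) // mxE fct_sumE; apply: eq_bigr => b _.
rewrite [_^T _ _]mxE mxE fct_sumE mulr_suml; apply: eq_bigr => a _.
by rewrite !mxE !fctE /= mxE.
Qed.

(** * Radial functions on the Sasaki manifold *)

Let sasaki := spherically_symmetric_metric B g h D (fun _ => 0) (fun _ => 0).

(** Restricting to the values of r in an open set S covers two cases: S = R for
    the affine functions, and r > 0, where alpha is differentiable in the usual
    sense. *)
Lemma laplace_beltrami_radial (S : set R) (F : Defs.total V -> R) (a b c : R -> R) e :
  open S -> (forall e, S (sq_norm h e) -> F e = a (sq_norm h e)) ->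
  (forall s, S s -> is_derive s 1 a (b s)) ->
  (forall s, S s -> is_derive s 1 b (c s)) ->
  S (sq_norm h e) ->
  laplace_beltrami sasaki F e =
  4 * sq_norm h e * c (sq_norm h e) + 2 * k%:R * b (sq_norm h e).
Proof.
move=> So Fa da db Se; rewrite /laplace_beltrami.
set x := chart_at A (tag e); set t := triv_at B (tag e).
have Ax : atlas A x := chart_at_atlas A (tag e).
have Bt : trivs B t := triv_at_trivs B (tag e).
have xe : cdom x (tag e) := chart_at_dom A (tag e).
have te : tdom t (tag e) := triv_at_dom B (tag e).
have Ue : (cmap x @` (cdom x `&` tdom t)) (cmap x (tag e)) by exists (tag e).
have [_ _ xK _ _] := atlas_homeo Ax.
rewrite -[bundle_chart_at B e]/(bundle_chart x t); set C := bundle_chart x t.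
set O := (lsubmx : 'rV[R]_(n + k) -> 'rV[R]_n) @^-1` (cmap x @` (cdom x `&` tdom t)).
have Oo : open O.
  by apply: open_comp (open_chart_image Ax (tdom_open Bt)) => z _; exact: continuous_lsubmx.
have Oz z : O z -> [/\ cdom x (tag (cinv C z)), tdom t (tag (cinv C z)),
    cmap C (cinv C z) = z & tcoord t (tagged (cinv C z)) = rsubmx z].
  move=> /(chart_image_inv Ax)[xz tz zE]; split=> //=; last exact: (tinvK Bt).
  by rewrite zE (tinvK Bt) // hsubmxK.
pose r := sq_norm h \o cinv C.
have CK : cinv C (cmap C e) = e.
  (* The fiber component lives over cinv x (cmap x (tag e)), which is tag e only
     propositionally; destructing e lets the equality be rewritten. *)
  case: e @x @t Se Ax Bt xe te Ue xK @C @O Oo Oz @r => p v x t Se Ax Bt xe te Ue xK C O Oo Oz r /=.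
  rewrite row_mxKl row_mxKr xK //.
  by rewrite (tcoordK Bt).
have rc z : O z -> {for z, continuous r}.
  have BC : bundle_atlas B C by exists x, t.
  by move=> Oz'; have := smooth_sq_norm BC 0%N; rewrite bundle_chart_image //; apply.
have OSo : open (O `&` r @^-1` S).
  rewrite openE => z [Oz' Sz].
  by apply: filterS2 (open_nbhs_nbhs (conj Oo Oz')) (rc z Oz' _ (open_nbhs_nbhs (conj So Sz))).
have rCe : r (cmap C e) = sq_norm h e := congr1 (sq_norm h) CK.
rewrite -rCe; apply: (@coord_laplacian_radial R n k _ (O `&` r @^-1` S)
  (fun y => \det (base_gram x (cinv x y)) * \det (fiber_gram t (cinv x y)))
  r (F \o cinv C) a b c).
- exact: OSo.
- move=> z [/Oz[xz tz _ _] _].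
  have := sasaki_gramE Ax Bt xz tz; rewrite /metric_coef => ->.
  exact: det_fibered_gram.
- move=> z [/Oz[xz tz _ _] _].
  by rewrite mulr_gt0 //; [exact: (det_base_gram_gt0 Ax)|exact: (det_fiber_gram_gt0 Bt)].
- move=> z [/Oz[xz tz Cz uz] _] j.
  have := is_derive_sq_norm Ax Bt xz tz j; rewrite Cz.
  have := sasaki_gramE Ax Bt xz tz; rewrite /metric_coef => ->.
  rewrite fibered_gramM (connection_map_ecoord Ax Bt) //.
  rewrite -[X in h _ X](tcoordK Bt tz) (fiber_gramE Bt) // uz.
  by rewrite -!row_mul mxE.
- move=> z [/Oz[xz tz Cz uz] _].
  have := sasaki_gramE Ax Bt xz tz; rewrite /metric_coef => ->.
  rewrite -mulmxA fibered_gramM /r /= (sq_norm_gram Bt) // uz.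
  rewrite tr_col_mx trmxK trmx0 !mulmxA mul_row_col mul0mx add0r mulmx1.
  by [].
- by move=> z [_ Sz]; exact: Fa.
- by move=> z [_ Sz]; exact: da.
- by move=> z [_ Sz]; exact: db.
- by split; rewrite /= ?rCe // /O /= row_mxKl.
Qed.

Lemma sq_norm_ge0 e : 0 <= sq_norm h e.
Proof.
have [/(_ (tag e))[_ _ hpos] _] := hP; rewrite /sq_norm.
have [->|v0] := eqVneq (tagged e) 0; last by rewrite ltW // hpos.
by rewrite inner_product0l //; case: hP.
Qed.

Lemma sq_norm_surj (s : R) : (0 < k)%N -> 0 <= s -> exists e : Defs.total V, sq_norm h e = s.
Proof.
move=> k0 s0; have [p _] := manifold_nonempty A.
pose t := triv_at B p; have Bt := triv_at_trivs B p; have tp := triv_at_dom B p.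
have [hp _] := hP; have [_ _ hpos] := hp p.
pose v := tinv t p (delta_mx 0 (Ordinal k0)).
have v0 : v != 0.
  apply/eqP => /(congr1 (tcoord t (p := p))); rewrite (tinvK Bt) // (tcoord0 Bt) //.
  move/rowP/(_ (Ordinal k0)); rewrite !mxE !eqxx => /eqP; rewrite oner_eq0; exact/negP.
have hv := hpos v v0.
exists (existT _ p (Num.sqrt (s / h v v) *: v)); rewrite /sq_norm /=.
rewrite (inner_productZl (hp p)) (inner_productC (hp p)) (inner_productZl (hp p)).
by rewrite mulrA -expr2 sqr_sqrtr ?divfK ?gt_eqF // divr_ge0 // ltW.
Qed.

Lemma smooth_sq_norm_affine (b0 b1 : R) :
  smooth_fun (bundle_atlas B) setT (fun e => b0 + b1 * sq_norm h e).
Proof.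
move=> C BC m; have := smooth_sq_norm BC m; move: BC => [c [t [Ac Bt ->]]].
rewrite bundle_chart_image // => sr.
have Oo : open ((lsubmx : 'rV[R]_(n + k) -> 'rV[R]_n) @^-1` (cmap c @` (cdom c `&` tdom t))).
  by apply: open_comp (open_chart_image Ac (tdom_open Bt)) => x _; exact: continuous_lsubmx.
apply: diff_class_eq (diff_classD Oo (diff_class_cst m _ b0)
  (diff_classM Oo (diff_class_cst m _ b1) sr)) => //.
Qed.

Lemma biharmonic_radial_affine (b0 b1 : R) (F : Defs.total V -> R) :
  (forall e, F e = b0 + b1 * sq_norm h e) -> biharmonic (bundle_atlas B) sasaki F.
Proof.
move=> FE; have -> : F = fun e => b0 + b1 * sq_norm h e by apply/funext.
split; first exact: smooth_sq_norm_affine.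
have lap (b0' b1' : R) e :
    laplace_beltrami sasaki (fun e => b0' + b1' * sq_norm h e) e = 2 * k%:R * b1'.
  have da (s : R) : setT s -> is_derive s 1 (fun s => b0' + b1' * s) (cst b1' s : R).
    move=> _; rewrite (_ : (fun _ => _) = cst b0' + (b1' \*o id)) //.
    by apply: is_derive_eq; rewrite /GRing.scale /= mulr1 add0r.
  have db (s : R) : setT s -> is_derive s 1 (cst b1' : R -> R) (cst 0 s : R).
    by move=> _; exact: is_derive_cst.
  have -> := laplace_beltrami_radial openT
    (fun e _ => erefl (b0' + b1' * sq_norm h e)) da db (I : setT (sq_norm h e)).
  by rewrite mulr0 add0r.
have lapF : laplace_beltrami sasaki (fun e => b0 + b1 * sq_norm h e) =
    fun e => 2 * k%:R * b1 + 0 * sq_norm h e.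
  by apply/funext => e; rewrite lap mul0r addr0.
by move=> e; rewrite lapF lap mulr0.
Qed.

End sasaki.

Theorem proposition3p5 (R : realType) (n k : nat) (M : topologicalType)
  (A : manifold R n M)
  (g : forall p, tangent (chart_at A) p -> tangent (chart_at A) p -> R)
  (V : M -> lmodType R) (B : vector_bundle A V k)
  (h : forall p, V p -> V p -> R)
  (D : forall p, tangent (chart_at A) p -> (forall q, V q) -> V p)
  (alpha : R -> R) :
  (1 <= k)%N ->
  riemannian_metric g ->
  fiber_metric B h ->
  connection B D ->
  metric_connection B h D ->
  smooth_halfline alpha ->
  (biharmonic (bundle_atlas B)
    (spherically_symmetric_metric B g h D (fun _ => 0) (fun _ => 0))
    (radial_function h alpha) <->
  (forall r : R, 0 <= r ->
     2 * r ^+ 2 * halfline_deriven 4 alpha r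
     + (3 * k + 4)%:R * r * halfline_deriven 3 alpha r
     + (k * (k + 2))%:R * halfline_deriven 2 alpha r = 0)).
Proof.
move=> k0 gP hP DP Dh sa; pose d j := halfline_deriven j alpha.
have dP j (s : R) : 0 < s -> is_derive s 1 (d j) (d j.+1 s).
  exact: is_derive_halfline_deriven.
split=> [[_ lap0] r r0|ode].
  have d2 : forall s, 0 < s -> d 2 s = 0.
    apply: (halfline_deriven2_eq0 sa (c := 2) (k := k)) => // s s0.
    have [e es] := sq_norm_surj hP k0 (ltW s0).
    have So : open [set s : R | 0 < s] by exact: open_gt.
    pose b s := 4 * s * d 2 s + 2 * k%:R * d 1 s.
    pose b' s := 4 * s * d 3 s + (2 * k%:R + 4) * d 2 s.
    pose b'' s := 4 * s * d 4 s + (2 * k%:R + 4 + 4) * d 3 s.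
    have db1 (x : R) : 0 < x -> is_derive x 1 b (b' x).
      by move=> x0; exact: is_derive_radial_laplacian (dP 1 x x0) (dP 2 x x0).
    have db2 (x : R) : 0 < x -> is_derive x 1 b' (b'' x).
      by move=> x0; exact: is_derive_radial_laplacian (dP 2 x x0) (dP 3 x x0).
    have lap1 e' : 0 < sq_norm h e' -> laplace_beltrami
        (spherically_symmetric_metric B g h D (fun _ => 0) (fun _ => 0))
        (radial_function h alpha) e' = b (sq_norm h e').
      exact: (laplace_beltrami_radial gP hP DP Dh So (fun _ _ => erefl) (dP 0) (dP 1)).
    have es0 : 0 < sq_norm h e by rewrite es.
    have := laplace_beltrami_radial gP hP DP Dh So lap1 db1 db2 es0.
    rewrite lap0 es /b' /b'' /d => E; move: E.
    move: (halfline_deriven 4 alpha s) (halfline_deriven 3 alpha s).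
    move: (halfline_deriven 2 alpha s) => x2 x4 x3 E.
    (* The bi-Laplacian is 4 times the Euler operator with c = 2. *)
    apply: (@mulfI _ (4 : R)); first by rewrite pnatr_eq0.
    by rewrite mulr0 [RHS]E !natrD !natrM !natrD; ring.
  have d20 := halfline_deriven2_at0 sa d2.
  have d3 := halfline_derivenS_eq0 sa d2; have d4 := halfline_derivenS_eq0 sa d3.
  (* At r = 0 the two higher derivatives come with a factor r. *)
  have vanish x4 x3 x2 : (0 < r -> x4 = 0) -> (0 < r -> x3 = 0) -> x2 = 0 ->
      2 * r ^+ 2 * x4 + (3 * k + 4)%:R * r * x3 + (k * (k + 2))%:R * x2 = 0.
    move=> e4 e3 ->; move: r0; rewrite le_eqVlt => /orP[/eqP r0|r0].
      by rewrite -r0 expr0n !mulr0 !mul0r !addr0.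
    by rewrite e4 // e3 // !mulr0 !addr0.
  apply: vanish; [exact: d4|exact: d3|].
  by move: r0; rewrite le_eqVlt => /orP[/eqP <-//|]; exact: d2.
have d2 : forall s, 0 < s -> d 2 s = 0.
  apply: (halfline_deriven2_eq0 sa (c := 1) (k := k)) => // s s0.
  rewrite -[RHS](ode s (ltW s0)).
  move: (halfline_deriven 4 alpha s) (halfline_deriven 3 alpha s).
  move: (halfline_deriven 2 alpha s) => x2 x4 x3.
  by rewrite !natrD !natrM !natrD; ring.
have [b0 [b1 aE]] := halfline_affine sa d2.
apply: (biharmonic_radial_affine gP hP DP Dh (b0 := b0) (b1 := b1)) => e.
by rewrite /radial_function aE // (sq_norm_ge0 hP).
Qed.
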